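(* Let $X$ be an infinite-dimensional complex Banach space and $T\in L(X)$. The following conditions are mutually equivalent: (i) there exists $(M,N)\in Red(T)$ such that $T_M$ is bounded below and $T_N$ is meromorphic; (ii) $T$ admits a generalized Kato-meromorphic decomposition and $0\notin\mathrm{int}\,\sigma_{ap}(T)$; (iii) $T$ admits a generalized Kato-meromorphic decomposition and $T$ has the SVEP at $0$; (iv) $T$ admits a generalized Kato-meromorphic decomposition and $0\notin\mathrm{acc}\,\sigma_{B\mathcal B_+}(T)$; (v) $T$ admits a generalized Kato-meromorphic decomposition and $0\notin\mathrm{int}\,\sigma_{B\mathcal B_+}(T)$.
   Context: $L(X)$ is the algebra of bounded linear operators on $X$; $N(T)$, $R(T)$ are kernel and range; $\sigma_{ap}(T)=\{\lambda\in\mathbb C:T-\lambda I\text{ is not bounded below}\}$ is the approximate point spectrum; $\mathrm{int}\,K$ and $\mathrm{acc}\,K$ are the sets of interior and accumulation points of $K\subset\mathbb C$. $(M,N)\in Red(T)$ means that $M,N$ are closed $T$-invariant subspaces with $X=M\oplus N$; $T_M$, $T_N$ are the restrictions of $T$ viewed as operators on $M$, $N$. $T$ is Kato if $R(T)$ is closed and $N(T)\subset R(T^n)$ for every $n\in\mathbb N$. An operator is meromorphic if every non-zero point of its spectrum is a pole of its resolvent. $T$ admits a generalized Kato-meromorphic decomposition if there is $(M,N)\in Red(T)$ with $T_M$ Kato and $T_N$ meromorphic. $T$ is upper semi-Browder if it is upper semi-Fredholm (finite-dimensional kernel and closed range) with finite ascent. $T$ is upper semi-B-Browder if there is an integer $n\ge0$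 such that $R(T^n)$ is closed and the restriction of $T$ to $R(T^n)$, viewed as a map $R(T^n)\to R(T^n)$, is upper semi-Browder; it is known that this is equivalent to left Drazin invertibility: the ascent $a(T)$ is finite and $R(T^{a(T)+1})$ is closed. $\sigma_{B\mathcal B_+}(T)=\{\lambda\in\mathbb C:T-\lambda I\text{ is not upper semi-B-Browder}\}$. $T$ has the SVEP (single-valued extension property) at $\lambda_0\in\mathbb C$ if for every open disc $\mathcal D_{\lambda_0}$ centered at $\lambda_0$ the only analytic function $f:\mathcal D_{\lambda_0}\to X$ satisfying $(T-\lambda)f(\lambda)=0$ for all $\lambda\in\mathcal D_{\lambda_0}$ is $f\equiv 0$. *)

(* Defs.v *)
From HB Require Import structures.
From mathcomp Require Import all_boot all_order all_algebra.
From mathcomp Require Import complex.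
From mathcomp Require Import all_classical all_reals all_analysis.

Set Implicit Arguments.
Unset Strict Implicit.
Unset Printing Implicit Defensive.

Import Order.TTheory GRing.Theory Num.Theory.
Import numFieldNormedType.Exports.

Local Open Scope classical_set_scope.
Local Open Scope ring_scope.
Local Open Scope complex_scope.

(* A linear subspace W of V, seen as a normed space in its own right: the     *)
(* norm is the one of V.                                                      *)
Section Subspace.
Variables (K : numFieldType) (V : normedModType K) (W : submodClosed V).

Definition subspaceType : Type := {x : V | x \in W}.

HB.instance Definition _ := SubChoice.on subspaceType.
HB.instance Definition _ := [SubChoice_isSubLmodule of subspaceType by <:].

Definition subspace_norm (x : subspaceType) : K := `|val x|.

Let ler_subspace_normD x y :
  subspace_norm (x + y) <= subspace_norm x + subspace_norm y.
Proof. exact: ler_normD. Qed.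

Let subspace_normZ (a : K) x : subspace_norm (a *: x) = `|a| * subspace_norm x.
Proof. exact: normrZ. Qed.

Let subspace_norm_eq0 x : subspace_norm x = 0 -> x = 0.
Proof. by move=> /normr0_eq0 x0; apply: val_inj. Qed.

HB.instance Definition _ := Lmodule_isNormed.Build K subspaceType
  ler_subspace_normD subspace_normZ subspace_norm_eq0.

Definition invariant_subspace (T : V -> V) := forall x, x \in W -> T x \in W.

Definition restr (T : V -> V) (TW : invariant_subspace T) (x : subspaceType) :
  subspaceType := exist _ (T (val x)) (TW (val x) (valP x)).

End Subspace.

Section Operators.
Variables (R : realType) (V : normedModType R[i]).
(* R[i]^o is R[i], as a normed space over itself. *)
Local Notation C := (R[i]^o).
Implicit Types (T S : V -> V) (A : set V) (lam mu : C).

Definition bounded_op T := linear T /\ continuous T.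

Definition finite_dim A := exists (n : nat) (b : 'I_n -> V),
  forall x, A x -> exists c : 'I_n -> R[i], x = \sum_(i < n) c i *: b i.

Definition nullspace T : set V := [set x | T x = 0].

Definition shift_op T lam : V -> V := fun x => T x - lam *: x.

Definition bounded_below T :=
  exists2 c : R[i], 0 < c & forall x, c * `|x| <= `|T x|.

Definition sigma_ap T : set C := [set lam | ~ bounded_below (shift_op T lam)].

Definition inverse_op T S := [/\ bounded_op S, cancel T S & cancel S T].

Definition spectrum T : set C :=
  [set lam | ~ exists S, inverse_op (shift_op T lam) S].

Definition Kato T :=
  closed (range T) /\ forall n, nullspace T `<=` range (iter n T).

(* Complex differentiability at mu of an operator-valued function, for the    *)
(* operator norm: the difference quotient minus D has norm at most e.         *)
Definition op_derivable (G : C -> V -> V) mu :=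
  exists2 D : V -> V, bounded_op D & forall e : R[i], 0 < e ->
    \forall h \near (0 : C)^',
      forall x, `|h^-1 *: (G (mu + h) x - G mu x) - D x| <= e * `|x|.

(* The resolvent mu |-> (T - mu)^-1 has a pole of order p > 0 at the isolated *)
(* point lam of the spectrum: it is (mu - lam)^-p * G(mu) near lam, where G   *)
(* is analytic near lam and G(lam) <> 0. Using (mu - T)^-1 instead would only *)
(* change the sign of G.                                                      *)
Definition resolvent_pole T lam :=
  isolated (spectrum T) lam /\
  exists (p : nat) (G : C -> V -> V),
    [/\ (0 < p)%N,
        \forall mu \near lam, bounded_op (G mu) /\ op_derivable G mu,
        exists x, G lam x != 0 &
        \forall mu \near lam^',
          inverse_op (shift_op T mu) (fun x => (mu - lam) ^- p *: G mu x)].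

Definition meromorphic T :=
  forall lam, lam != 0 -> spectrum T lam -> resolvent_pole T lam.

Definition finite_ascent T :=
  exists p : nat, nullspace (iter p T) = nullspace (iter p.+1 T).

Definition upper_semi_Fredholm T :=
  finite_dim (nullspace T) /\ closed (range T).

Definition upper_semi_Browder T := upper_semi_Fredholm T /\ finite_ascent T.

Definition SVEP T lam0 := forall r : R[i], 0 < r -> forall f : C -> V,
  (forall mu, ball lam0 r mu -> derivable f mu 1) ->
  (forall mu, ball lam0 r mu -> shift_op T mu (f mu) = 0) ->
  forall mu, ball lam0 r mu -> f mu = 0.

Record Red T (M N : submodClosed V) : Prop := {
  red_closedl : closed [set` M] ;
  red_closedr : closed [set` N] ;
  red_invl : invariant_subspace M T ;
  red_invr : invariant_subspace N T ;
  red_sum : forall x, exists y z, [/\ y \in M, z \in N & x = y + z] ;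
  red_cap : forall x, x \in M -> x \in N -> x = 0 }.

End Operators.

Section BBrowder.
Variables (R : realType) (V : normedModType R[i]).
Implicit Type T : V -> V.

(* W is the subspace R(T^n), so that restr TW is the map R(T^n) -> R(T^n)     *)
(* induced by T.                                                              *)
Definition upper_semi_B_Browder T :=
  exists (n : nat) (W : submodClosed V) (TW : invariant_subspace W T),
    [/\ [set` W] = range (iter n T), closed (range (iter n T)) &
        upper_semi_Browder (restr TW)].

Definition sigma_BB T : set R[i]^o :=
  [set lam | ~ upper_semi_B_Browder (shift_op T lam)].

Definition gen_Kato_meromorphic T :=
  exists (M N : submodClosed V) (MN : Red T M N),
    Kato (restr (red_invl MN)) /\ meromorphic (restr (red_invr MN)).

End BBrowder.

(* Main.v *)
(* A Kato operator which is not injective has a sequence x_0 <> 0, T x_0 = 0,  *)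
(* T x_(k+1) = x_k, |x_k| <= |x_0| c^k: the preimages of a vector of the       *)
(* intersection of the R(T^n) stay in it because N(T) is contained in every    *)
(* R(T^n), and the open mapping theorem bounds them. Then                      *)
(* f(lam) = sum_k lam^k x_k is analytic with (T - lam) f(lam) = 0 and          *)
(* f(0) <> 0, and similar series give infinite Jordan chains of T - lam for    *)
(* every small lam; this contradicts (ii), (iii) and (v). So in these cases    *)
(* T_M is injective with closed range, hence bounded below.                    *)
(*                                                                             *)
(* Conversely let T_M be bounded below and T_N meromorphic. For small lam,     *)
(* T_M - lam is bounded below, and non-zero points of the spectrum of T_N are  *)
(* isolated; this gives (ii). If (T - lam) f(lam) = 0 on a disc, the N-part of *)
(* f vanishes by continuity, and its M-part vanishes near 0, hence everywhere  *)
(* by the identity theorem. The latter is obtained for functions that are only *)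
(* pointwise differentiable, from Goursat's argument applied to discrete       *)
(* midpoint sums along squares and Cauchy's estimate for f(w) / (w - p)^n.     *)
(* Finally, at a pole of order p of the resolvent of T_N, the same estimate    *)
(* applied to lam |-> (T_N - lam)^-1 (T_N - lam_0)^p y shows that T_N - lam_0  *)
(* is bounded below on R((T_N - lam_0)^p), which is closed; this gives (iv).   *)

From HB Require Import structures.
Require Import Defs.
From mathcomp Require Import all_boot all_order all_algebra.
From mathcomp Require Import complex.
From mathcomp Require Import all_classical all_reals all_analysis.
From mathcomp Require Import ring lra.
Import numFieldNormedType.Exports.
Import Order.TTheory GRing.Theory Num.Theory.
Set Implicit Arguments.
Unset Strict Implicit.
Unset Printing Implicit Defensive.

Local Open Scope classical_set_scope.
Local Open Scope ring_scope.
Local Open Scope complex_scope.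

(** * Norms, convergence, completeness *)

(** Everything turns on the kernel of the Kato summand T_M. If T_M is injective, its closed range
    and the open mapping theorem make it bounded below, which is (i). Otherwise a kernel vector
    starts an infinite backward orbit of geometric growth, an [eigenchain], which is also one for T;
    this alternative is [gen_Kato_meromorphic_dichotomy]. An eigenchain puts a whole disc around 0
    into both spectra ([eigenchain_not_bounded_below], [eigenchain_not_BBrowder]) and yields a
    non-zero analytic solution ([eigenchain_not_SVEP]), so each of (ii), (iii), (v) leads back to
    (i).

    From (i), [bounded_below_summandP] obtains (ii), (iii) and (iv) by treating the two summands
    separately through the continuous projections of [red_projections]. The SVEP uses
    [identity_at_center], and the poles of the resolvent of T_N are handled by [pole_range]; both
    rest on [cauchy_bound], a Cauchy estimate without integrals: midpoint sums cancel exactly along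
    shared sides and vanish exactly on affine functions.

    In the cycle of implications, (ii) to (iii) and (iii) to (iv) pass through (i), and (iv) gives
    (v) because an interior point is an accumulation point. *)

Section RealNorm.
Variable R : realType.
Implicit Type V : normedZmodType R[i].

(* The norm of a normed R[i]-module is R[i]-valued; the order of R[i] is partial. *)
Definition nrm V (x : V) : R := complex.Re `|x|.

Lemma nrmE V (x : V) : `|x| = (nrm x)%:C.
Proof. by have := normr_ge0 x; rewrite lecE /nrm; case: `|x| => a b /= /andP[/eqP -> _]. Qed.

Lemma nrm_ge0 V (x : V) : 0 <= nrm x.
Proof. by rewrite -ler0c -nrmE normr_ge0. Qed.

Lemma nrm0 V : nrm (0 : V) = 0.
Proof. by rewrite /nrm normr0. Qed.

Lemma nrm0_eq0 V (x : V) : nrm x = 0 -> x = 0.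
Proof. by move=> x0; apply/normr0_eq0; rewrite nrmE x0. Qed.

Lemma nrm_gt0 V (x : V) : x <> 0 -> 0 < nrm x.
Proof. by move=> x0; rewrite lt_neqAle nrm_ge0 andbT eq_sym; apply/eqP => /nrm0_eq0. Qed.

Lemma nrmN V (x : V) : nrm (- x) = nrm x.
Proof. by rewrite /nrm normrN. Qed.

Lemma nrmB V (x y : V) : nrm (x - y) = nrm (y - x).
Proof. by rewrite /nrm distrC. Qed.

Lemma nrmD V (x y : V) : nrm (x + y) <= nrm x + nrm y.
Proof. by rewrite -lecR rmorphD /= -!nrmE ler_normD. Qed.

Lemma nrmBD V (x y : V) : nrm (x - y) <= nrm x + nrm y.
Proof. by rewrite -(nrmN y) nrmD. Qed.

Lemma nrm_le_dist V (x y : V) : nrm x <= nrm y + nrm (x - y).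
Proof. by have := nrmD y (x - y); rewrite addrC subrK. Qed.

Lemma nrm_dist_tri V (x y z : V) : nrm (x - z) <= nrm (x - y) + nrm (y - z).
Proof. by have := nrmD (x - y) (y - z); rewrite addrA subrK. Qed.

Lemma nrmZ (V : normedModType R[i]) (a : R[i]) (x : V) : nrm (a *: x) = nrm a * nrm x.
Proof. by apply: (@complexI R); rewrite rmorphM /= -!nrmE normrZ. Qed.

Lemma nrmM (a b : R[i]) : nrm (a * b) = nrm a * nrm b.
Proof. by apply: (@complexI R); rewrite rmorphM /= -!nrmE normrM. Qed.

Lemma nrmC (k : R) : nrm k%:C = `|k|.
Proof. by rewrite /nrm normc_def /= expr0n /= addr0 sqrtr_sqr. Qed.

Lemma nrmV (a : R[i]) : nrm a^-1 = (nrm a)^-1.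
Proof. by apply: (@complexI R); rewrite -nrmE normfV fmorphV nrmE. Qed.

Lemma nrmX (a : R[i]) n : nrm (a ^+ n) = nrm a ^+ n.
Proof. by apply: (@complexI R); rewrite -nrmE normrX rmorphXn /= nrmE. Qed.

Lemma nrm_Re (a : R[i]) : `|complex.Re a| <= nrm a.
Proof.
rewrite -(ler_pXn2r (n := 2)) ?nnegrE ?nrm_ge0 // /nrm normc_def /= sqr_sqrtr; last first.
  by rewrite addr_ge0 ?sqr_ge0.
by rewrite real_normK ?num_real // lerDl sqr_ge0.
Qed.

Lemma nrm_Im (a : R[i]) : `|complex.Im a| <= nrm a.
Proof.
rewrite -(ler_pXn2r (n := 2)) ?nnegrE ?nrm_ge0 // /nrm normc_def /= sqr_sqrtr; last first.
  by rewrite addr_ge0 ?sqr_ge0.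
by rewrite real_normK ?num_real // lerDr sqr_ge0.
Qed.

Lemma nrm_le_ReIm (a : R[i]) : nrm a <= `|complex.Re a| + `|complex.Im a|.
Proof.
rewrite -(ler_pXn2r (n := 2)) ?nnegrE ?addr_ge0 ?nrm_ge0 // /nrm normc_def /= sqr_sqrtr.
  by rewrite sqrrD !real_normK ?num_real // lerD2r lerDl mulrn_wge0 ?mulr_ge0.
by rewrite addr_ge0 ?sqr_ge0.
Qed.

Lemma gt0C (r : R[i]) : 0 < r -> 0 < complex.Re r /\ r = (complex.Re r)%:C.
Proof. by rewrite ltcE; case: r => a b /= /andP[/eqP -> ->]. Qed.

Lemma nrm_lt V (x : V) (r : R) : (`|x| < r%:C) = (nrm x < r).
Proof. by rewrite nrmE ltcR. Qed.

End RealNorm.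

Section RealNormTopology.
Variables (R : realType) (V : normedModType R[i]).
Implicit Types (x y : V) (A : set V) (P : V -> Prop).

Lemma near_nrm x P :
  (\forall y \near x, P y) <-> exists2 d : R, 0 < d & forall y, nrm (x - y) < d -> P y.
Proof.
split.
  move=> /nbhs_normP[e /= e0 Pe]; have [e0' eE] := gt0C e0.
  by exists (complex.Re e) => // y xy; apply: Pe; rewrite /ball_ /= eE nrm_lt.
move=> [d d0 Pd]; apply/nbhs_normP; exists d%:C => [|y /=]; first by rewrite /= ltcR.
by rewrite nrm_lt => /Pd.
Qed.

Definition converges_to (u : nat -> V) x :=
  forall e : R, 0 < e -> exists N, forall n, (N <= n)%N -> nrm (u n - x) < e.

Lemma closed_seq A : closed A <->
  forall u x, (forall n, A (u n)) -> converges_to u x -> A x.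
Proof.
split=> [cA u x Au ux | cA x clx].
  apply: cA => B /near_nrm[d d0 Bd]; have [N Nd] := ux d d0.
  by exists (u N); split=> //; apply: Bd; rewrite nrmB Nd.
have pick n : exists y, A y /\ nrm (y - x) < (n.+1%:R : R)^-1.
  have [|y [Ay]] := clx [set y | nrm (x - y) < n.+1%:R^-1].
    by apply/near_nrm; exists n.+1%:R^-1; rewrite // invr_gt0.
  by rewrite /= nrmB => ?; exists y.
have [u uP] := choice pick; apply: (cA u) => [n|e e0]; first by have [] := uP n.
exists (Num.truncn e^-1) => n Nn; have [_ /lt_le_trans] := uP n; apply.
rewrite -[leRHS]invrK lef_pV2 ?posrE ?invr_gt0 //.
by apply: (le_trans (ltW (truncnS_gt e^-1))); rewrite ler_nat ltnS.
Qed.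

Lemma converges_to_unique u x y : converges_to u x -> converges_to u y -> x = y.
Proof.
move=> ux uy; apply/subr0_eq/nrm0_eq0/eqP; rewrite eq_le nrm_ge0 andbT.
apply/ler_addgt0Pr => e e0; rewrite add0r.
have e2 : 0 < e / 2 by lra.
have [N1 P1] := ux _ e2; have [N2 P2] := uy _ e2.
have := P1 _ (leq_maxl N1 N2); have := P2 _ (leq_maxr N1 N2).
have := nrm_dist_tri x (u (maxn N1 N2)) y; rewrite (nrmB x (u _)); lra.
Qed.

End RealNormTopology.

Section Completeness.
Variable R : realType.

(** Stated for normed modules because the open mapping theorem is applied to T_M and to the sum map
    M x N -> X, where closed subspaces and products carry only a norm. *)
Definition seq_complete (V : normedModType R[i]) := forall u : nat -> V,
  (forall e : R, 0 < e -> exists N, forall m n, (N <= m)%N -> (N <= n)%N -> nrm (u m - u n) < e) ->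
  exists x, converges_to u x.

Lemma completeNormedMod_seq (V : completeNormedModType R[i]) : seq_complete V.
Proof.
move=> u cu; have : cvg (u @ \oo).
  apply: cauchy_cvg; apply: cauchy_exP => e e0; have [e0' ->] := gt0C e0.
  have [N NP] := cu _ e0'; exists (u N); rewrite /fmapE.
  by exists N => // n /= Nn; rewrite -ball_normE /ball_ /= nrm_lt NP.
move=> /cvg_ex[x ux]; exists x => e e0.
have /cvgrPdist_lt/(_ e%:C) := ux; rewrite ltcR => /(_ e0)[N _ NP].
by exists N => n Nn; rewrite nrmB -nrm_lt NP.
Qed.

Lemma subspace_seq_complete (V : normedModType R[i]) (W : submodClosed V) :
  seq_complete V -> closed [set` W] -> seq_complete (subspaceType W).
Proof.
move=> cV /closed_seq cW u cu; have [x ux] := cV (fun n => val (u n)) cu.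
have Wx : x \in W by apply: (cW (fun n => val (u n))) => // n; apply: (valP (u n)).
by exists (exist _ x Wx : subspaceType W).
Qed.

Lemma nrm_prod (V W : normedModType R[i]) (z : V * W) : nrm z = Num.max (nrm z.1) (nrm z.2).
Proof.
apply: (@complexI R); rewrite -nrmE prod_normE /Order.max !nrmE ltcR.
by case: ifP.
Qed.

Lemma prod_seq_complete (V W : normedModType R[i]) :
  seq_complete V -> seq_complete W -> seq_complete (V * W)%type.
Proof.
have nrmP (p : V * W) (e : R) : (nrm p < e) = (nrm p.1 < e) && (nrm p.2 < e).
  by rewrite nrm_prod gt_max.
move=> cV cW u cu.
have [|x ux] := cV (fun n => (u n).1).
  by move=> e /cu[N NP]; exists N => m n mN nN; have := NP m n mN nN; rewrite nrmP => /andP[].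
have [|y uy] := cW (fun n => (u n).2).
  by move=> e /cu[N NP]; exists N => m n mN nN; have := NP m n mN nN; rewrite nrmP => /andP[].
exists (x, y) => e e0; have [N1 P1] := ux e e0; have [N2 P2] := uy e e0.
exists (maxn N1 N2) => n; rewrite geq_max nrmP => /andP[n1 n2].
by rewrite P1 // P2.
Qed.

Lemma geometric_lt (c e : R) : 0 < e -> exists N, c / 2 ^+ N < e.
Proof.
move=> e0; set n := (Num.truncn (e^-1 * c)).+1; exists n.
rewrite ltr_pdivrMr ?exprn_gt0 // -ltr_pdivrMl //.
by apply: lt_trans (truncnS_gt _) _; rewrite -natrX ltr_nat -/n ltn_expl.
Qed.

Lemma geometric_le0 (a c : R) : (forall k, a <= c / 2 ^+ k) -> a <= 0.
Proof.
move=> ac; apply/ler_addgt0Pr => e e0; rewrite add0r.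
by have [N /ltW NP] := geometric_lt c e0; exact: le_trans NP.
Qed.

(** The explicit tail bound serves the Baire argument, successive approximation, Neumann series and
    the lifting of limits at a pole. *)
Lemma geometric_cvg (V : normedModType R[i]) (u : nat -> V) (A : R) :
  seq_complete V -> (forall k, nrm (u k.+1 - u k) <= A / 2 ^+ k) ->
  exists x, forall k, nrm (x - u k) <= 2 * A / 2 ^+ k.
Proof.
move=> cV uA.
have A0 : 0 <= A by have := uA 0%N; have := nrm_ge0 (u 1%N - u 0%N); rewrite expr0 divr1; lra.
have step k j : nrm (u (k + j)%N - u k) <= 2 * A / 2 ^+ k - 2 * A / 2 ^+ (k + j).
  elim: j => [|j IH]; first by rewrite addn0 !subrr nrm0.
  have := nrm_dist_tri (u (k + j).+1) (u (k + j)%N) (u k).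
  rewrite addnS; have := uA (k + j)%N; have -> : A / 2 ^+ (k + j) = 2 * (A / 2 ^+ (k + j).+1).
    by rewrite exprS; field; rewrite expf_neq0.
  move: IH; have -> : 2 * A / 2 ^+ (k + j) = 2 * (2 * A / 2 ^+ (k + j).+1).
    by rewrite [in RHS]exprS; field; rewrite expf_neq0.
  rewrite -mulrA; lra.
have step' k j : nrm (u (k + j)%N - u k) <= 2 * A / 2 ^+ k.
  by apply: (le_trans (step k j)); rewrite gerBl divr_ge0 ?mulr_ge0 ?exprn_ge0.
have [|x ux] := cV u.
  move=> e e0; have e2 : 0 < e / 2 by lra.
  have [N NP] := geometric_lt (2 * A) e2; exists N => m n /subnKC <- /subnKC <-.
  have := nrm_dist_tri (u (N + (m - N))%N) (u N) (u (N + (n - N))%N).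
  have := step' N (m - N)%N; have := step' N (n - N)%N.
  by rewrite (nrmB (u N) (u (N + (n - N))%N)); lra.
exists x => k; apply/ler_addgt0Pr => e e0; have [N NP] := ux e e0.
have := nrm_dist_tri x (u (k + N)%N) (u k); have := NP _ (leq_addl k N); have := step' k N.
by rewrite (nrmB x (u (k + N)%N)); lra.
Qed.

End Completeness.

(** * Bounded operators and the open mapping theorem *)

Section BoundedOperators.
Variables (R : realType) (V W : normedModType R[i]).

Lemma nrm_rescale (x : V) (r : R) : 0 < r -> x <> 0 ->
  nrm ((r / nrm x)%:C *: x) = r.
Proof.
move=> r0 /nrm_gt0 x0; rewrite nrmZ nrmC ger0_norm ?divr_ge0 ?ltW //.
by rewrite divfK // gt_eqF.
Qed.

Lemma linear_continuousP (T : {linear V -> W}) :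
  continuous T <-> exists2 K : R, 0 < K & forall x, nrm (T x) <= K * nrm x.
Proof.
split=> [cT | [K K0 TK] x].
  have /cvgrPdist_lt/(_ 1 ltr01)/near_nrm[d d0 dP] := cT 0.
  exists (2 / d) => [|x]; first by rewrite divr_gt0.
  have [-> | /eqP x0] := eqVneq x 0; first by rewrite linear0 !nrm0 mulr0.
  have /= := dP ((d / 2 / nrm x)%:C *: x).
  rewrite sub0r nrmN nrm_rescale ?divr_gt0 // => /(_ _)/wrap[|]; first by lra.
  rewrite linear0 sub0r normrN -[1 in ltRHS]/(1%:C) nrm_lt linearZ nrmZ nrmC.
  have n0 := nrm_gt0 x0; have dn : 0 < d / 2 / nrm x by rewrite !divr_gt0.
  rewrite (ger0_norm (ltW dn)) => h.
  apply: ltW; move: h; rewrite -ltr_pdivlMl // => /lt_le_trans; apply.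
  by rewrite (_ : _ * 1 = 2 / d * nrm x) //; field; rewrite !gt_eqF.
apply/cvgrPdist_lt => e e0; have [e0' ->] := gt0C e0.
apply/near_nrm; exists (complex.Re e / K) => [|y]; first by rewrite divr_gt0.
rewrite ltr_pdivlMr // mulrC nrm_lt -linearB; exact: le_lt_trans.
Qed.

End BoundedOperators.

Section OpenMapping.
Variables (R : realType) (V W : normedModType R[i]) (T : {linear V -> W}).
Hypotheses (cV : seq_complete V) (cW : seq_complete W).
Hypotheses (Tc : continuous T) (Tcl : closed (range T)).

(* Baire's theorem, applied to the closures of the images of the balls of V. *)
Let almost_open_ball : exists n y0 (r : R), [/\ 0 < r, range T y0 &
  forall y, range T y -> nrm (y - y0) < r -> forall e : R, 0 < e ->
    exists2 x, nrm x <= n%:R & nrm (T x - y) < e].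
Proof.
apply: contrapT => H.
(* If the claim fails, every ball centred in the range contains a smaller one that T of the ball of
   radius n avoids. *)
have step (p : nat * (W * R)) : exists q : W * R,
    range T p.2.1 /\ 0 < p.2.2 -> [/\ range T q.1, 0 < q.2,
      nrm (q.1 - p.2.1) <= p.2.2 / 2, q.2 <= p.2.2 / 2 &
      forall x, nrm x <= p.1%:R -> q.2 < nrm (T x - q.1)].
  case: p => n [y0 r] /=; case: (pselect (range T y0 /\ 0 < r)) => [[Ty0 r0]|]; last by exists (y0, r).
  have r2 : 0 < r / 2 by lra.
  have : ~ forall y, range T y -> nrm (y - y0) < r / 2 -> forall e : R, 0 < e ->
      exists2 x, nrm x <= n%:R & nrm (T x - y) < e.
    by move=> A; apply: H; exists n, y0, (r / 2).
  move=> /existsNP[y /not_implyP[Ty /not_implyP[yy0 /existsNP[e /not_implyP[e0 ne]]]]].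
  exists (y, Num.min (e / 2) (r / 2)) => _; split=> //=.
  - by rewrite lt_min r2 divr_gt0.
  - exact: ltW.
  - by rewrite ge_min lexx orbT.
  move=> x xn; rewrite gt_min; apply/orP; left; apply: contrapT => /negP; rewrite -leNgt => h.
  by apply: ne; exists x => //; lra.
have [g gP] := choice step.
pose s := fix s n := if n is m.+1 then g (m, s m) else (0, 1).
have s0 n : range T (s n).1 /\ 0 < (s n).2.
  by elim: n => [|n /(gP (n, s n))[]] //=; split=> //; exists 0; rewrite ?linear0.
have sS n := gP (n, s n) (s0 n).
have r2 n : (s n).2 <= 1 / 2 ^+ n.
  elim: n => [|n IH]; first by rewrite expr0 divr1.
  have [_ _ _ /le_trans + _] := sS n; apply.
  by rewrite exprS invfM; move: IH; lra.
have [y yl] : exists y, forall k, nrm (y - (s k).1) <= 2 * 2^-1 / 2 ^+ k.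
  apply: (@geometric_cvg _ _ (fun k => (s k).1)) => // k.
  have [_ _ /le_trans + _ _] := sS k; apply.
  by rewrite mulrC ler_pM2l // -div1r r2.
have nest k j : nrm ((s (k + j)%N).1 - (s k).1) <= (s k).2 - (s (k + j)%N).2.
  elim: j => [|j IH]; first by rewrite addn0 !subrr nrm0.
  rewrite addnS; have [_ _ + + _] := sS (k + j)%N; rewrite -[g _]/(s (k + j).+1) => a b.
  by have := nrm_dist_tri (s (k + j).+1).1 (s (k + j)%N).1 (s k).1; move: a b IH; rewrite /=; lra.
have yk k : nrm (y - (s k).1) <= (s k).2.
  apply/ler_addgt0Pr => e e0; have [N NP] := geometric_lt 1 e0.
  have := nrm_dist_tri y (s (k + N)%N).1 (s k).1; have := nest k N.
  have := yl (k + N)%N; have [_ sp] := s0 (k + N)%N.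
  have : 2 * 2^-1 / 2 ^+ (k + N) <= 1 / 2 ^+ N :> R.
    rewrite divff // ler_pM2l // lef_pV2 ?posrE ?exprn_gt0 //.
    by rewrite ler_eXn2l ?ltr1n // leq_addl.
  lra.
have [x _ Tx] : range T y.
  move/closed_seq: Tcl; apply; first by move=> n; exact: (s0 n).1.
  move=> e e0; have [N NP] := geometric_lt 1 e0; exists N => n nN.
  rewrite nrmB (le_lt_trans (yl n)) // (le_lt_trans _ NP) // divff //.
  by rewrite ler_pM2l // lef_pV2 ?posrE ?exprn_gt0 // ler_eXn2l ?ltr1n.
(* The limit y = T x lies in all the nested balls, but the one built at a stage exceeding |x| avoids
   T x. *)
have [_ _ _ _ /(_ x)] := sS (Num.truncn (nrm x)).+1; rewrite ltW ?truncnS_gt // => /(_ isT).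
by rewrite Tx ltNge (yk (Num.truncn (nrm x)).+2).
Qed.

(** Both y0 and y0 + t y lie in the good ball for t = r / (2 |y|); subtracting their approximate
    preimages and dividing by t gives one for y. *)
Let almost_preimage : exists2 C : R, 0 < C & forall y, range T y -> forall e : R, 0 < e ->
  exists2 x, nrm x <= C * nrm y & nrm (T x - y) < e.
Proof.
have [n [y0 [r [r0 Ty0 H]]]] := almost_open_ball.
(* The two preimages contribute 2 n / t = 4 n |y| / r; the + 1 keeps the constant positive when n =
   0. *)
exists (4 * (n%:R + 1) / r) => [|y Ty e e0]; first by rewrite divr_gt0 ?mulr_gt0 // ltr_wpDl.
have [-> | /eqP y_neq0] := eqVneq y 0.
  by exists 0; [rewrite !nrm0 mulr0 | rewrite linear0 subr0 nrm0].
have y_gt0 := nrm_gt0 y_neq0; set t := r / 2 / nrm y.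
have t0 : 0 < t by rewrite !divr_gt0.
have te : 0 < t * e / 2 by apply: divr_gt0 => //; apply: mulr_gt0.
have Ty1 : range T (y0 + t%:C *: y).
  have [a _ <-] := Ty0; have [b _ <-] := Ty; exists (a + t%:C *: b) => //.
  by rewrite linearD linearZ.
have y1r : nrm (y0 + t%:C *: y - y0) < r.
  by rewrite addrC addKr nrm_rescale ?divr_gt0 //; lra.
have [x1 x1n Tx1] := H _ Ty1 y1r _ te.
have y0r : nrm (y0 - y0) < r by rewrite subrr nrm0.
have [x2 x2n Tx2] := H _ Ty0 y0r _ te.
exists (t^-1%:C *: (x1 - x2)).
  rewrite nrmZ nrmC gtr0_norm ?invr_gt0 //.
  rewrite /t invf_div mulrC mulrA ler_pdivrMr ?divr_gt0 //.
  have -> : 4 * (n%:R + 1) / r * nrm y * (r / 2) = 2 * (n%:R + 1) * nrm y.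
    by field; rewrite gt_eqF.
  rewrite ler_pM2r //; have := nrmBD x1 x2; lra.
have -> : T (t^-1%:C *: (x1 - x2)) - y = t^-1%:C *: ((T x1 - (y0 + t%:C *: y)) - (T x2 - y0)).
  have tE : t^-1%:C *: (t%:C *: y) = y.
    by rewrite scalerA -rmorphM /= mulVf ?gt_eqF // scale1r.
  rewrite [T x1 - _](_ : _ = - y0 + (T x1 - t%:C *: y)); last by rewrite opprD addrCA.
  rewrite [- (T x2 - y0)]opprB addrACA addNr add0r addrAC linearZ linearB.
  by rewrite [in RHS]scalerBr tE.
rewrite nrmZ nrmC gtr0_norm ?invr_gt0 // ltr_pdivrMl //.
by have := nrmBD (T x1 - (y0 + t%:C *: y)) (T x2 - y0); lra.
Qed.

(** Successive approximation: each correction halves the residual y - T s_n, so the corrections sum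
    to at most 2 C |y|. A closed range replaces surjectivity. *)
Theorem open_mapping : exists2 C : R, 0 < C &
  forall x, exists2 x', T x' = T x & nrm x' <= C * nrm (T x).
Proof.
have [C C0 CP] := almost_preimage; have [K K0 KP] := (linear_continuousP T).1 Tc.
have step y : exists x, range T y -> nrm x <= C * nrm y /\ nrm (y - T x) <= nrm y / 2.
  case: (pselect (range T y)) => [Ty|]; last by exists 0.
  have [-> | /eqP /nrm_gt0 y0] := eqVneq y 0.
    by exists 0; rewrite linear0 subr0 !nrm0 mulr0 mul0r.
  have [|x xC xy] := CP y Ty (nrm y / 2); first by lra.
  by exists x => _; split=> //; rewrite nrmB; exact: ltW.
have [g gP] := choice step.
exists (2 * C) => [|x0]; first by rewrite mulr_gt0.
set y := T x0; pose s := fix s n := if n is m.+1 then s m + g (y - T (s m)) else 0.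
have Ty n : range T (y - T (s n)) by exists (x0 - s n); rewrite ?linearB.
have yn n : nrm (y - T (s n)) <= nrm y / 2 ^+ n.
  elim: n => [|n IH]; first by rewrite /= linear0 subr0 expr0 divr1.
  have [_] := gP _ (Ty n); rewrite /= linearD opprD addrA => /le_trans; apply.
  by rewrite exprSr invfM mulrA ler_pM2r.
have [|x xs] := @geometric_cvg _ _ s (C * nrm y) cV.
  move=> k; rewrite /= addrC addKr; have [+ _] := gP _ (Ty k) => /le_trans; apply.
  by rewrite -mulrA ler_pM2l.
exists x; last by have := xs 0%N; rewrite subr0 expr0 divr1 mulrA.
apply/subr0_eq/nrm0_eq0/eqP; rewrite eq_le nrm_ge0 andbT.
apply: (@geometric_le0 _ _ (K * (2 * (C * nrm y)) + nrm y)) => k.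
have := nrm_dist_tri (T x) (T (s k)) y; rewrite -[T x - T (s k)]linearB (nrmB (T (s k))).
have := yn k; have := KP (x - s k); have := xs k; rewrite -(ler_pM2l K0).
lra.
Qed.

Lemma injective_closed_range_bounded_below : (forall x, T x = 0 -> x = 0) ->
  exists2 c : R, 0 < c & forall x, c * nrm x <= nrm (T x).
Proof.
move=> injT; have [C C0 CP] := open_mapping; exists C^-1; rewrite ?invr_gt0 // => x.
have [x' Tx'] := CP x; rewrite ler_pdivrMl // => /(le_trans _); apply.
by have /injT/subr0_eq -> : T (x - x') = 0 by rewrite linearB Tx' subrr.
Qed.

End OpenMapping.

(** * Complex derivatives *)

Section ComplexDerivative.
Variables (R : realType) (V : normedModType R[i]).
Local Notation C := (R[i]^o).
Implicit Types (f : C -> V) (z w : C).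

Lemma near_dnbhs_nrm (P : C -> Prop) z : (\forall w \near z^', P w) <->
  exists2 d : R, 0 < d & forall w, w != z -> nrm (z - w) < d -> P w.
Proof.
have nP := near_nrm (V := C) z (fun w => w != z -> P w).
rewrite near_withinE; split=> [/nP[d d0 dP] | [d d0 dP]].
  by exists d => // w wz /dP; exact.
by apply/nP; exists d => // w /[swap]; exact: dP.
Qed.

(** The remainder form has no division by h, so h = 0 needs no exception. *)
Lemma derivable_nrmP f z : derivable f z 1 <-> exists D, forall e : R, 0 < e ->
  exists2 d : R, 0 < d & forall h, nrm h < d -> nrm (f (z + h) - f z - h *: D) <= e * nrm h.
Proof.
have quotE D h : h != 0 ->
    nrm h * nrm (D - h^-1 *: (f (z + h) - f z)) = nrm (f (z + h) - f z - h *: D).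
  by move=> h0; rewrite -nrmZ scalerBr scalerA divff // scale1r nrmB.
split=> [/cvg_ex[D /cvgrPdist_lt DP] | [D DP]].
  exists D => e e0; have e0C : 0 < e%:C by rewrite ltcR.
  have /near_dnbhs_nrm[d d0 dP] := DP _ e0C.
  exists d => // h; have [->|h0] := eqVneq h 0.
    by rewrite addr0 subrr scale0r subrr !nrm0 mulr0.
  move=> hd; rewrite -quotE // mulrC ler_wpM2r ?nrm_ge0 // ltW // -nrm_lt.
  by have := dP h h0; rewrite sub0r nrmN /= [_ *: 1]mulr1 (addrC h z); apply.
apply/cvg_ex; exists D; apply/cvgrPdist_lt => e e0; have [e0' ->] := gt0C e0.
have [|d d0 dP] := DP (complex.Re e / 2); first by rewrite divr_gt0.
apply/near_dnbhs_nrm; exists d => // h h0; rewrite sub0r nrmN => hd.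
have hn : 0 < nrm h by apply: nrm_gt0; apply/eqP.
rewrite nrm_lt /= [_ *: 1]mulr1 (addrC h z); have := dP h hd; rewrite -quotE // mulrC ler_pM2r //.
lra.
Qed.

Lemma derivable_eq_near f g z (d : R) : 0 < d -> (forall w, nrm (w - z) < d -> f w = g w) ->
  derivable g z 1 -> derivable f z 1.
Proof.
move=> d0 fg /derivable_nrmP[D DP]; apply/derivable_nrmP; exists D => e /DP[d' d'0 dP'].
exists (Num.min d d') => [|h]; first by rewrite lt_min d0.
by rewrite lt_min => /andP[hd hd']; rewrite !fg ?subrr ?nrm0 // ?dP' // addrC addKr.
Qed.

Lemma derivable_scale (phi : C -> C) f z : derivable phi z 1 -> derivable f z 1 ->
  derivable (fun w => phi w *: f w) z 1.
Proof.
move=> dphi df; have cphi : phi (h *: 1 + z) @[h --> (0 : C)^'] --> phi z.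
  have /differentiable_continuous/cvgrPdist_lt phic : differentiable phi z.
    by apply/derivable1_diffP.
  apply/cvgrPdist_lt => e e0; have /near_nrm[d d0 dP] := phic e e0.
  apply/near_dnbhs_nrm; exists d => // h h0; rewrite sub0r nrmN => hd.
  by apply: dP; rewrite [_ *: 1]mulr1 nrmB addrK.
have /cvg_ex[a aP] := dphi; have /cvg_ex[b bP] := df.
apply/cvg_ex; exists (phi z *: b + a *: f z).
rewrite (_ : (fun h : C => h^-1 *: _) = (fun h : C => phi (h *: 1 + z) *: (h^-1 *: (f (h *: 1 + z) - f z))
    + (h^-1 *: (phi (h *: 1 + z) - phi z)) *: f z)).
  apply: cvgD; last by apply: cvgZ; [exact: aP | exact: cvg_cst].
  apply: cvgZ; [exact: cphi | exact: bP].
apply/funext => h /=; set p := phi (h *: 1 + z); set q := f (h *: 1 + z).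
rewrite -[h^-1 *: (p - phi z)]/(h^-1 * (p - phi z)) scalerA mulrC -!scalerA -scalerDr.
by rewrite scalerBl [p *: (q - _)]scalerBr addrA subrK.
Qed.

End ComplexDerivative.

(** * Midpoint sums along the boundary of a square *)

Section MidpointSums.
Variables (R : realType).
Local Notation C := (R[i]^o).

Definition midpoint (a b : R[i]) : R[i] := (a + b) / 2.

Lemma halfC : (2 : R[i])^-1 = (2^-1)%:C.
Proof. by rewrite fmorphV rmorph_nat. Qed.

Lemma Re_midpoint (a b : R[i]) :
  complex.Re (midpoint a b) = (complex.Re a + complex.Re b) / 2.
Proof. by rewrite /midpoint halfC; case: a => a a'; case: b => b b' /=; rewrite mulr0 subr0. Qed.

Lemma Im_midpoint (a b : R[i]) :
  complex.Im (midpoint a b) = (complex.Im a + complex.Im b) / 2.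
Proof. by rewrite /midpoint halfC; case: a => a a'; case: b => b b' /=; rewrite mulr0 add0r. Qed.

Lemma midpoint_sym a b : midpoint a b = midpoint b a.
Proof. by rewrite /midpoint addrC. Qed.

(** [seg] evaluates f only at iterated midpoints, so this is all the convexity that bounding it
    requires. *)
Definition midconvex (P : R[i] -> Prop) := forall a b, P a -> P b -> P (midpoint a b).

Variable V : normedModType R[i].
Implicit Type f : C -> V.

(* The composite midpoint rule with 2^n steps for the integral of f from a to b. *)
Fixpoint seg f n (a b : R[i]) : V :=
  if n is m.+1 then seg f m a (midpoint a b) + seg f m (midpoint a b) b
  else (b - a) *: f (midpoint a b).

Lemma seg_sym f n a b : seg f n b a = - seg f n a b.
Proof.
elim: n a b => [|n IH] a b /=; first by rewrite midpoint_sym -scaleNr opprB.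
by rewrite IH [X in _ + X]IH -opprD addrC midpoint_sym.
Qed.

Lemma segB f g n a b : seg (fun w => f w - g w) n a b = seg f n a b - seg g n a b.
Proof.
elim: n a b => [|n IH] a b /=; first by rewrite scalerBr.
by rewrite !IH opprD addrACA.
Qed.

(** The midpoint rule is exact on affine functions, and the values of the primitive telescope. *)
Lemma seg_affine (u v : V) n a b :
  seg (fun w => u + w *: v) n a b = (b *: u + (b ^+ 2 / 2) *: v) - (a *: u + (a ^+ 2 / 2) *: v).
Proof.
elim: n a b => [|n IH] a b /=; last by rewrite !IH addrC addrA subrK.
rewrite scalerDr scalerA opprD addrACA -!scalerBl; congr (_ + _ *: _).
by rewrite /midpoint -[RHS]/((b ^+ 2 - a ^+ 2) * 2^-1); field.
Qed.

Lemma seg_bound f (P : R[i] -> Prop) (M : R) n a b : midconvex P ->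
  (forall w, P w -> nrm (f w) <= M) -> P a -> P b -> nrm (seg f n a b) <= M * nrm (b - a).
Proof.
move=> cP fM; elim: n a b => [|n IH] a b Pa Pb /=.
  by rewrite nrmZ mulrC ler_wpM2r ?nrm_ge0 // fM //; exact: cP.
have Pm := cP _ _ Pa Pb; apply: le_trans (nrmD _ _) _.
have half : nrm (2^-1 : R[i]) = 2^-1 by rewrite halfC nrmC gtr0_norm ?invr_gt0.
have := IH _ _ Pa Pm; have := IH _ _ Pm Pb.
have -> : b - midpoint a b = 2^-1 * (b - a) by rewrite /midpoint; field.
have -> : midpoint a b - a = 2^-1 * (b - a) by rewrite /midpoint; field.
rewrite nrmM half; lra.
Qed.

End MidpointSums.

Section Contour.
Variables (R : realType) (V : normedModType R[i]).
Local Notation C := (R[i]^o).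
Implicit Types (f g : C -> V) (x y s : R).

(* The midpoint rule along the positively oriented boundary of the square *)
(* [x, x + s] x [y, y + s].                                               *)
Definition contour f n x y s : V :=
  seg f n (x +i* y) ((x + s) +i* y) + seg f n ((x + s) +i* y) ((x + s) +i* (y + s))
  + seg f n ((x + s) +i* (y + s)) (x +i* (y + s)) + seg f n (x +i* (y + s)) (x +i* y).

Definition in_square x y s (w : R[i]) :=
  x <= complex.Re w <= x + s /\ y <= complex.Im w <= y + s.

Definition on_boundary x y s (w : R[i]) := in_square x y s w /\
  [\/ complex.Re w = x, complex.Re w = x + s, complex.Im w = y | complex.Im w = y + s].

Lemma contourB f g n x y s :
  contour (fun w => f w - g w) n x y s = contour f n x y s - contour g n x y s.
Proof.
have subACA (a b c d : V) : a - b + (c - d) = a + c - (b + d) by rewrite opprD addrACA.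
by rewrite /contour !segB !subACA.
Qed.

Lemma contour_affine (u v : V) n x y s : contour (fun w => u + w *: v) n x y s = 0.
Proof.
have telescope (a b c : V) : b - a + (c - b) = c - a by rewrite addrC addrA subrK.
by rewrite /contour !seg_affine !telescope subrr.
Qed.

Lemma midpoint_complex (a b c d : R) :
  midpoint (a +i* b) (c +i* d) = ((a + c) / 2) +i* ((b + d) / 2).
Proof. by apply/eqP; rewrite eq_complex Re_midpoint Im_midpoint !eqxx. Qed.

(** An exact identity: sides shared by two quarters are run through in opposite directions. One
    level of subdivision is spent on halving the sides. *)
Lemma contour_quadrisect f n x y s : contour f n.+1 x y s =
  contour f n x y (s / 2) + contour f n (x + s / 2) y (s / 2)
  + contour f n x (y + s / 2) (s / 2) + contour f n (x + s / 2) (y + s / 2) (s / 2).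
Proof.
rewrite /contour /= !midpoint_complex.
have dbl (a : R) : (a + a) / 2 = a by field.
have h1 (a : R) : (a + (a + s)) / 2 = a + s / 2 by field.
have h2 (a : R) : (a + s + a) / 2 = a + s / 2 by field.
have h3 (a : R) : a + s / 2 + s / 2 = a + s by field.
rewrite !dbl !h1 !h2 !h3.
set m := (x + s / 2) +i* (y + s / 2).
rewrite (seg_sym f n ((x + s / 2) +i* y) m) (seg_sym f n (x +i* (y + s / 2)) m).
rewrite (seg_sym f n ((x + s) +i* (y + s / 2)) m) (seg_sym f n ((x + s / 2) +i* (y + s)) m).
(* The first four pairs make up the outer sides, the last four cancel. *)
rewrite [RHS](AC (4*4*4*4) ((1*5)*(6*14)*(15*11)*(12*4)*(2*8)*(7*13)*(16*10)*(9*3))).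
by rewrite /= !subrr !addr0.
Qed.

Lemma contour_bound f n x y s (M : R) : 0 <= s ->
  (forall w, on_boundary x y s w -> nrm (f w) <= M) -> nrm (contour f n x y s) <= 4 * s * M.
Proof.
move=> s0 fM.
have Hc (c : R) : midconvex (fun w => in_square x y s w /\ complex.Im w = c).
  move=> a b [[/andP[? ?] /andP[? ?]] ?] [[/andP[? ?] /andP[? ?]] ?]; split;
    last by rewrite Im_midpoint; lra.
  by rewrite /in_square Re_midpoint Im_midpoint; split; apply/andP; split; lra.
have Vc (c : R) : midconvex (fun w => in_square x y s w /\ complex.Re w = c).
  move=> a b [[/andP[? ?] /andP[? ?]] ?] [[/andP[? ?] /andP[? ?]] ?]; split;
    last by rewrite Re_midpoint; lra.
  by rewrite /in_square Re_midpoint Im_midpoint; split; apply/andP; split; lra.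
have xx : x <= x <= x + s by apply/andP; split; lra.
have xs : x <= x + s <= x + s by apply/andP; split; lra.
have yy : y <= y <= y + s by apply/andP; split; lra.
have ys : y <= y + s <= y + s by apply/andP; split; lra.
have n1 : nrm ((s +i* 0) : R[i]) <= s.
  by apply: le_trans (nrm_le_ReIm _) _; rewrite /= normr0 ger0_norm ?addr0.
have n2 : nrm ((0 +i* s) : R[i]) <= s.
  by apply: le_trans (nrm_le_ReIm _) _; rewrite /= normr0 ger0_norm ?add0r.
have M0 : 0 <= M by apply: le_trans (nrm_ge0 _) (fM (x +i* y) _); split; [split | constructor 1].
have side P a b : midconvex P -> (forall w, P w -> on_boundary x y s w) -> P a -> P b ->
    nrm (b - a) <= s -> nrm (seg f n a b) <= s * M.
  move=> cP Pb Pa Pb' ab; rewrite mulrC; apply: le_trans (ler_wpM2l M0 ab).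
  by apply: (seg_bound _ cP) => // w /Pb; exact: fM.
apply: le_trans (nrmD _ _) _; apply: (@le_trans _ _ (s * M + s * M + s * M + s * M)); last by lra.
apply: lerD; last first.
  apply: (side _ _ _ (Vc x)) => [w [? ?]|||] //; first by split=> //; constructor 1.
  rewrite -[_ - _]/((x - x) +i* (y - (y + s))) subrr opprD addNKr -nrmN.
  by apply: le_trans n2; rewrite -[- _]/((- 0) +i* (- - s)) oppr0 opprK.
apply: le_trans (nrmD _ _) _; apply: lerD; last first.
  apply: (side _ _ _ (Hc (y + s))) => [w [? ?]|||] //; first by split=> //; constructor 4.
  rewrite -[_ - _]/((x - (x + s)) +i* (y + s - (y + s))) subrr opprD addNKr -nrmN.
  by apply: le_trans n1; rewrite -[- _]/((- - s) +i* (- 0)) oppr0 opprK.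
apply: le_trans (nrmD _ _) _; apply: lerD.
  apply: (side _ _ _ (Hc y)) => [w [? ?]|||] //; first by split=> //; constructor 3.
  by rewrite -[_ - _]/((x + s - x) +i* (y - y)) subrr addrC addKr.
apply: (side _ _ _ (Vc (x + s))) => [w [? ?]|||] //; first by split=> //; constructor 2.
by rewrite -[_ - _]/((x + s - (x + s)) +i* (y + s - y)) subrr [y + s]addrC addrK.
Qed.

End Contour.

(** * Goursat's lemma *)

Section Goursat.
Variables (R : realType).
Local Notation C := (R[i]^o).

(** Bisection in place of compactness (Cousin's lemma): if P failed, it would fail on nested squares
    shrinking to a point, against the local hypothesis at that point. *)
Lemma square_induction (P : R -> R -> R -> Prop) x0 y0 s0 : 0 < s0 ->
  (forall x y s, 0 < s -> P x y (s / 2) -> P (x + s / 2) y (s / 2) ->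
    P x (y + s / 2) (s / 2) -> P (x + s / 2) (y + s / 2) (s / 2) -> P x y s) ->
  (forall z, in_square x0 y0 s0 z -> exists2 d : R, 0 < d &
    forall x y s, 0 < s < d -> in_square x y s z -> P x y s) ->
  P x0 y0 s0.
Proof.
move=> s0_gt0 glue loc; apply: contrapT => nP0.
have step (q : R * R * R) : exists q' : R * R * R, 0 < q.2 /\ ~ P q.1.1 q.1.2 q.2 ->
    [/\ q'.2 = q.2 / 2, ~ P q'.1.1 q'.1.2 q'.2,
      q.1.1 <= q'.1.1 /\ q'.1.1 + q'.2 <= q.1.1 + q.2 &
      q.1.2 <= q'.1.2 /\ q'.1.2 + q'.2 <= q.1.2 + q.2].
  case: q => [[x y] s] /=; case: (pselect (0 < s /\ ~ P x y s)) => [[s_gt0 nP]|];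
    last by exists (x, y, s).
  apply: contrapT => H; apply: nP; apply: glue => //; apply: contrapT => nP; apply: H.
  - by exists (x, y, s / 2) => _; split=> //=; split; lra.
  - by exists (x + s / 2, y, s / 2) => _; split=> //=; split; lra.
  - by exists (x, y + s / 2, s / 2) => _; split=> //=; split; lra.
  - by exists (x + s / 2, y + s / 2, s / 2) => _; split=> //=; split; lra.
have [g gP] := choice step; pose q n := iter n g (x0, y0, s0).
have qP n : 0 < (q n).2 /\ ~ P (q n).1.1 (q n).1.2 (q n).2.
  by elim: n => [|n IH] //=; have [-> nP _ _] := gP _ IH; split=> //; case: IH => *; lra.
have qS n := gP _ (qP n); have qs n : (q n).2 = s0 / 2 ^+ n.
  elim: n => [|n IH]; first by rewrite expr0 divr1.
  by have [-> _ _ _] := qS n; rewrite IH exprSr invfM mulrA.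
have nest n k : [/\ (q n).1.1 <= (q (n + k)%N).1.1,
    (q (n + k)%N).1.1 + (q (n + k)%N).2 <= (q n).1.1 + (q n).2,
    (q n).1.2 <= (q (n + k)%N).1.2 & (q (n + k)%N).1.2 + (q (n + k)%N).2 <= (q n).1.2 + (q n).2].
  elim: k => [|k [? ? ? ?]]; first by rewrite addn0.
  rewrite addnS; have [_ _ [? ?] [? ?]] := qS (n + k)%N; rewrite -[q (n + k).+1]/(g (q (n + k)%N)).
  by split; lra.
have cross n m : (q m).1.1 <= (q n).1.1 + (q n).2 /\ (q m).1.2 <= (q n).1.2 + (q n).2.
  have [a1 _ a2 _] := nest m n; have [_ b1 _ b2] := nest n m.
  by have [c1 _] := qP (n + m)%N; rewrite addnC in a1 a2; split; lra.
(* The lower left corners never decrease and never pass an upper right one, so their suprema give a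
   point of all the squares. *)
pose X := range (fun n => (q n).1.1); pose Y := range (fun n => (q n).1.2).
have inX n : (q n).1.1 <= sup X <= (q n).1.1 + (q n).2.
  apply/andP; split;
    last by apply: ge_sup => [|_ [m _ <-]]; [exists (q 0%N).1.1; exists 0%N | have [] := cross n m].
  by apply: ub_le_sup; [exists ((q 0%N).1.1 + (q 0%N).2) => _ [m _ <-]; have [] := cross 0%N m | exists n].
have inY n : (q n).1.2 <= sup Y <= (q n).1.2 + (q n).2.
  apply/andP; split;
    last by apply: ge_sup => [|_ [m _ <-]]; [exists (q 0%N).1.2; exists 0%N | have [] := cross n m].
  by apply: ub_le_sup; [exists ((q 0%N).1.2 + (q 0%N).2) => _ [m _ <-]; have [] := cross 0%N m | exists n].
have [|d d0 dP] := loc (sup X +i* sup Y); first by split; [exact: (inX 0%N) | exact: (inY 0%N)].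
have [n nd] := geometric_lt s0 d0; have [qn nP] := qP n; apply: nP; apply: dP.
  by rewrite qn qs.
by split; [exact: inX | exact: inY].
Qed.

Lemma in_square_dist x y s (z w : R[i]) : in_square x y s z -> in_square x y s w ->
  nrm (w - z) <= 2 * s.
Proof.
case: z w => [a b] [c d] [/andP[/= ? ?] /andP[/= ? ?]] [/andP[/= ? ?] /andP[/= ? ?]].
apply: le_trans (nrm_le_ReIm _) _; rewrite -[_ - _]/((c - a) +i* (d - b)) /=.
have : `|c - a| <= s by rewrite ler_norml; apply/andP; split; lra.
have : `|d - b| <= s by rewrite ler_norml; apply/andP; split; lra.
lra.
Qed.

Variable V : normedModType R[i].
Implicit Type f : C -> V.

(** The bound c s^2 is additive under quadrisection, since it is proportional to the area. On small
    squares around z, subtracting the affine part of f leaves a sum of order o(s) times the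
    perimeter 4 s. The bound holds only for large n because each quadrisection uses up one level. *)
Lemma contour_cvg0 f x0 y0 s0 : 0 < s0 ->
  (forall z, in_square x0 y0 s0 z -> derivable f z 1) ->
  forall e : R, 0 < e -> exists N, forall n, (N <= n)%N -> nrm (contour f n x0 y0 s0) <= e.
Proof.
move=> s0_gt0 df e e_gt0; set c := e / s0 ^+ 2.
have c0 : 0 < c by rewrite divr_gt0 ?exprn_gt0.
suff : exists N, forall n, (N <= n)%N -> nrm (contour f n x0 y0 s0) <= c * s0 ^+ 2.
  by rewrite divfK // expf_neq0 // gt_eqF.
apply: (@square_induction (fun x y s => exists N, forall n, (N <= n)%N ->
  nrm (contour f n x y s) <= c * s ^+ 2)) => //.
  move=> x y s s_gt0 [N1 P1] [N2 P2] [N3 P3] [N4 P4].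
  exists (maxn (maxn N1 N2) (maxn N3 N4)).+1 => -[//|n]; rewrite ltnS !geq_max.
  case/andP=> /andP[n1 n2] /andP[n3 n4]; rewrite contour_quadrisect.
  have := P1 n n1; have := P2 n n2; have := P3 n n3; have := P4 n n4.
  set a1 := contour _ _ _ _ _; set a2 := contour _ _ _ _ _.
  set a3 := contour _ _ _ _ _; set a4 := contour _ _ _ _ _.
  have := nrmD (a4 + a3 + a2) a1; have := nrmD (a4 + a3) a2; have := nrmD a4 a3.
  rewrite expr_div_n; lra.
(* The square lies within 2 s of z, whence d / 2; the constants satisfy 4 s (c / 8) (2 s) = c
   s^2. *)
move=> z /df/derivable_nrmP[D DP]; have c8 : 0 < c / 8 by lra.
have [d d0 dP] := DP _ c8; exists (d / 2) => [|x y s /andP[s_gt0 sd] zs]; first by lra.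
exists 0%N => n _.
have -> : contour f n x y s = contour (fun w => f w - (f z - z *: D + w *: D)) n x y s.
  by rewrite contourB contour_affine subr0.
have -> : c * s ^+ 2 = 4 * s * (c / 8 * (2 * s)) by field.
apply: contour_bound; first exact: ltW.
move=> w [ws _]; have := in_square_dist zs ws => wz.
have := dP (w - z); rewrite (_ : z + (w - z) = w); last by rewrite addrC subrK.
rewrite scalerBl -addrA -opprD addrA addrAC => h.
by apply: le_trans (h _) _; [lra | rewrite ler_pM2l].
Qed.

End Goursat.

(** * Bounded functions with one exceptional point *)

Section CauchyBound.
Variables (R : realType) (V : normedModType R[i]).
Local Notation C := (R[i]^o).
Implicit Types (f : C -> V) (x y s a b : R).

(** Column and row of the twelve border cells, in the order in which two successive quadrisections
    produce them. *)
Let outer : seq (nat * nat) :=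
  [:: (0, 0); (1, 0); (0, 1); (2, 0); (3, 0); (3, 1); (0, 2); (0, 3); (1, 3); (3, 2); (2, 3); (3, 3)]%N.

(* Of the 16 squares of the 4 x 4 subdivision, the 4 inner ones form a square. *)
Lemma contour_inner_outer f n x y s : contour f n.+2 x y s =
  contour f n.+1 (x + s / 4) (y + s / 4) (s / 2) +
  \sum_(p <- outer) contour f n (x + p.1%:R * (s / 4)) (y + p.2%:R * (s / 4)) (s / 4).
Proof.
rewrite !contour_quadrisect !big_cons big_nil /=.
have h4 : s / 2 / 2 = s / 4 by field.
have e1 t : t + s / 4 + s / 4 = t + s / 2 by field.
have e2 t : t + 2%:R * (s / 4) = t + s / 2 by field.
have e3 t : t + 3%:R * (s / 4) = t + s / 2 + s / 4 by field.
rewrite !h4 !e1 !e2 !e3 !mul0r !addr0 !mul1r.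
by rewrite [LHS](AC (4*4*4*4) (4*7*10*13*(1*(2*(3*(5*(6*(8*(9*(11*(12*(14*(15*16))))))))))))).
Qed.

Lemma eventually_sum_le (I : eqType) (r : seq I) (F : nat -> I -> V) :
  (forall i, i \in r -> forall e : R, 0 < e -> exists N, forall n, (N <= n)%N -> nrm (F n i) <= e) ->
  forall e : R, 0 < e -> exists N, forall n, (N <= n)%N -> nrm (\sum_(i <- r) F n i) <= e.
Proof.
elim: r => [|i r IH] Fr e e0; first by exists 0%N => n _; rewrite big_nil nrm0 ltW.
have e2 : 0 < e / 2 by lra.
have [N1 P1] := Fr i (mem_head _ _) _ e2.
have [|N2 P2] := IH _ _ e2; first by move=> j jr; apply: Fr; rewrite in_cons jr orbT.
exists (maxn N1 N2) => n; rewrite geq_max => /andP[/P1 ? /P2 ?]; rewrite big_cons.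
by have := nrmD (F n i) (\sum_(j <- r) F n j); lra.
Qed.

(** The border cells avoid the centre, so Goursat's lemma disposes of them and leaves the concentric
    square of half the side. After k rounds the perimeter bound is 4 s B / 2^k. *)
Lemma contour_cvg0_hole f a b s0 (B : R) : 0 < s0 ->
  (forall w, in_square (a - s0 / 2) (b - s0 / 2) s0 w -> w <> a +i* b -> derivable f w 1) ->
  (forall w, in_square (a - s0 / 2) (b - s0 / 2) s0 w -> nrm (f w) <= B) ->
  forall e : R, 0 < e -> exists N, forall n, (N <= n)%N ->
    nrm (contour f n (a - s0 / 2) (b - s0 / 2) s0) <= e.
Proof.
move=> s0_gt0 df fB.
have key k s : 0 < s <= s0 -> forall e : R, 0 < e -> exists N, forall n, (N <= n)%N ->
    nrm (contour f n (a - s / 2) (b - s / 2) s) <= e + 4 * s * B / 2 ^+ k.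
  elim: k s => [|k IH] s /andP[s_gt0 s_le] e e_gt0.
    exists 0%N => n _; rewrite expr0 divr1; apply: ler_wpDl; first exact: ltW.
    apply: contour_bound; first exact: ltW.
    move=> w [[/andP[? ?] /andP[? ?]] _]; apply: fB; split; apply/andP; split; lra.
  have e2 : 0 < e / 2 by lra.
  have [|N1 P1] := IH (s / 2) _ _ e2; first by apply/andP; split; lra.
  pose Q n (p : nat * nat) :=
    contour f n (a - s / 2 + p.1%:R * (s / 4)) (b - s / 2 + p.2%:R * (s / 4)) (s / 4).
  have [|N2 P2] := @eventually_sum_le _ outer Q _ _ e2.
    move=> p pO; apply: contour_cvg0 => [|w [/andP[w1 w2] /andP[w3 w4]]]; first by lra.
    (* An extreme row or column index keeps the cell away from the centre, which belongs to the
       inner cells only. *)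
    have [p13 p23 p03] : [/\ (p.1 <= 3)%N, (p.2 <= 3)%N &
        [\/ p.1 = 0%N, p.1 = 3%N, p.2 = 0%N | p.2 = 3%N]].
      move: pO; rewrite !inE.
      by do ![case/orP | move=> /eqP-> /=]; split=> //;
        first [by constructor 1 | by constructor 2 | by constructor 3 | by constructor 4].
    move: (ler0n R p.1) (ler0n R p.2) p13 p23 p03; rewrite -!(ler_nat R).
    set i : R := p.1%:R in w1 w2 *; set j : R := p.2%:R in w3 w4 * => i0 j0 i3 j3 p03.
    have ij : [\/ i = 0, i = 3, j = 0 | j = 3].
      by case: p03; rewrite /i /j => ->;
        [constructor 1 | constructor 2 | constructor 3 | constructor 4].
    have is0 : 0 <= i * s by rewrite mulr_ge0 // ltW.
    have is3 : i * s <= 3 * s by rewrite ler_pM2r.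
    have js0 : 0 <= j * s by rewrite mulr_ge0 // ltW.
    have js3 : j * s <= 3 * s by rewrite ler_pM2r.
    apply: df => [|wE]; first by split; apply/andP; split; lra.
    rewrite wE /= in w1 w2 w3 w4.
    by move: w1 w2 w3 w4; case: ij => ->; lra.
  exists (maxn N1 N2).+2 => -[//|[//|n]]; rewrite !ltnS geq_max => /andP[n1 n2].
  rewrite contour_inner_outer; apply: le_trans (nrmD _ _) _.
  have := P2 n n2; have := P1 n.+1 (leqW n1).
  have <- : a - s / 2 + s / 4 = a - s / 2 / 2 by field.
  have <- : b - s / 2 + s / 4 = b - s / 2 / 2 by field.
  rewrite (_ : 4 * s * B / 2 ^+ k.+1 = 4 * (s / 2) * B / 2 ^+ k); last first.
    by rewrite exprS; field; rewrite expf_neq0.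
  lra.
move=> e e_gt0; have e2 : 0 < e / 2 by lra.
have [k kP] := geometric_lt (4 * s0 * B) e2.
have [|N NP] := key k s0 _ _ e2; first by rewrite s0_gt0 lexx.
by exists N => n /NP; lra.
Qed.

End CauchyBound.

(** * A lower bound for the sums of the Cauchy kernel *)

Section CauchyKernel.
Variables (R : realType).
Local Notation C := (R[i]^o).
Implicit Types (z d : R[i]) (t u v : R).

(** The imaginary part is t / (u^2 + t^2), and |u| <= t. *)
Lemma Im_kernel t u : 0 < t -> - t <= u <= t ->
  1 / (2 * t) <= complex.Im ((u +i* (- t)) : R[i])^-1.
Proof.
move=> t0 /andP[u1 u2]; rewrite /= sqrrN mulNr opprK; have p : 0 < u ^+ 2 + t ^+ 2.
  by rewrite ltr_wpDl ?sqr_ge0 ?exprn_gt0.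
by rewrite ler_pdivrMr ?mulr_gt0 // mulrAC ler_pdivlMr // mul1r; nra.
Qed.

(** The factor d cancels in dw / (w - z). With d = 1, i, -1, -i it rotates the bottom side onto each
    of the four sides. *)
Lemma seg_kernel z d t n u v : d != 0 -> 0 < t -> - t <= u -> u <= v -> v <= t ->
  (v - u) / (2 * t) <= complex.Im
    (seg (fun w : C => (w - z)^-1 : C) n (z + d * (u +i* (- t))) (z + d * (v +i* (- t)))).
Proof.
move=> d0 t0; elim: n u v => [|n IH] u v tu uv vt;
  have m : midpoint (z + d * (u +i* (- t))) (z + d * (v +i* (- t))) = z + d * (((u + v) / 2) +i* (- t)).
  1,3: rewrite -[X in _ = z + d * X](_ : midpoint (u +i* - t) (v +i* - t) = _);
    [by rewrite /midpoint; field | by rewrite midpoint_complex; congr (_ +i* _); field].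
  have inv : - t <= (u + v) / 2 <= t by apply/andP; split; lra.
  have := Im_kernel t0 inv; set k := (_ +i* _)^-1; rewrite /= m => hk.
  have -> : (z + d * (v +i* - t) - (z + d * (u +i* - t))) *: (z + d * (((u + v) / 2) +i* - t) - z)^-1
      = (v - u)%:C * k :> R[i].
    rewrite opprD addrACA subrr add0r -mulrBr [z + _ - z]addrAC subrr add0r.
    rewrite -[_ *: _]/(_ * _) invfM mulrACA divff // mul1r.
    by congr (_ * _); rewrite -[_ - _]/((v - u) +i* (- t - - t)) subrr.
  have -> : complex.Im ((v - u)%:C * k) = (v - u) * complex.Im k.
    by case: (k) => ? ? /=; rewrite mul0r addr0.
  by rewrite div1r in hk; rewrite ler_wpM2l ?subr_ge0.
rewrite /= m; set A := seg _ _ _ _; set B := seg _ _ _ _.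
have a1 : ((u + v) / 2 - u) / (2 * t) <= complex.Im A by apply: IH; lra.
have a2 : (v - (u + v) / 2) / (2 * t) <= complex.Im B by apply: IH; lra.
have -> : complex.Im (A + B) = complex.Im A + complex.Im B by case: (A) (B) => [? ?] [? ?].
lra.
Qed.

(** The integral is 2 pi i, but a lower bound is enough for Cauchy's estimate: each side contributes
    at least 1 to the imaginary part. *)
Lemma contour_kernel a b s n : 0 < s ->
  4 <= nrm (contour (fun w : C => (w - (a +i* b))^-1 : C) n (a - s / 2) (b - s / 2) s).
Proof.
move=> s0; have t0 : 0 < s / 2 by lra.
have tt : - (s / 2) <= s / 2 by lra.
set h := s / 2 in t0 tt *.
have side p q x1 y1 x2 y2 : (p +i* q : R[i]) != 0 ->
    x1 = a + (p * - h + q * h) -> y1 = b + (q * - h - p * h) ->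
    x2 = a + (p * h + q * h) -> y2 = b + (q * h - p * h) ->
    1 <= complex.Im (seg (fun w : C => (w - (a +i* b))^-1 : C) n (x1 +i* y1) (x2 +i* y2)).
  move=> pq -> -> -> ->; have corner u : (a + (p * u + q * h)) +i* (b + (q * u - p * h)) =
      a +i* b + (p +i* q) * (u +i* - h) :> R[i].
    rewrite -[X in _ = _ + X]/((p * u - q * - h) +i* (p * - h + q * u)).
    by rewrite -[RHS]/((_ + _) +i* (_ + _)); congr (_ +i* _); ring.
  rewrite !corner; apply: le_trans (seg_kernel _ n pq t0 (lexx _) tt (lexx _)).
  by rewrite le_eqVlt; apply/orP; left; apply/eqP; field; rewrite gt_eqF.
have n1 : (1 +i* 0 : R[i]) != 0 by rewrite eq_complex /= oner_eq0.
have n2 : (0 +i* 1 : R[i]) != 0 by rewrite eq_complex /= oner_eq0 andbF.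
have n3 : (-1 +i* 0 : R[i]) != 0 by rewrite eq_complex /= oppr_eq0 oner_eq0.
have n4 : (0 +i* -1 : R[i]) != 0 by rewrite eq_complex /= oppr_eq0 oner_eq0 andbF.
rewrite /contour; set A1 := seg _ _ _ _; set A2 := seg _ _ _ _.
set A3 := seg _ _ _ _; set A4 := seg _ _ _ _.
have sE : s = 2 * h by rewrite /h; field.
have a1 : 1 <= complex.Im A1 by apply: side n1 _ _ _ _; rewrite ?sE; ring.
have a2 : 1 <= complex.Im A2 by apply: side n2 _ _ _ _; rewrite ?sE; ring.
have a3 : 1 <= complex.Im A3 by apply: side n3 _ _ _ _; rewrite ?sE; ring.
have a4 : 1 <= complex.Im A4 by apply: side n4 _ _ _ _; rewrite ?sE; ring.
apply: le_trans (nrm_Im _); apply: le_trans (ler_norm _).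
have ImD (c d : R[i]) : complex.Im (c + d) = complex.Im c + complex.Im d by case: c d => [? ?] [? ?].
by rewrite !ImD; lra.
Qed.

End CauchyKernel.

(** * Cauchy's estimate and the identity theorem *)

Section IdentityTheorem.
Variables (R : realType) (V : normedModType R[i]).
Local Notation C := (R[i]^o).
Implicit Types (f F : C -> V) (a b s : R).

Lemma seg_scalel (phi : C -> C) (v : V) n p q :
  seg (fun w => phi w *: v) n p q = (seg phi n p q : R[i]) *: v.
Proof.
elim: n p q => [|n IH] p q /=; first by rewrite -[in RHS]scalerA.
by rewrite !IH -scalerDl.
Qed.

Lemma contour_scalel (phi : C -> C) (v : V) n x y s :
  contour (fun w => phi w *: v) n x y s = (contour phi n x y s : R[i]) *: v.
Proof. by rewrite /contour !seg_scalel -!scalerDl. Qed.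

Lemma bounded_on_square f x y s : 0 < s ->
  (forall z, in_square x y s z -> exists2 d : R, 0 < d & exists B : R,
    forall w, nrm (w - z) < d -> nrm (f w) <= B) ->
  exists B : R, forall w, in_square x y s w -> nrm (f w) <= B.
Proof.
move=> s_gt0 loc; apply: (@square_induction _ (fun x y s =>
  exists B : R, forall w, in_square x y s w -> nrm (f w) <= B)) => //.
  move=> x1 y1 s1 s1_gt0 [B1 H1] [B2 H2] [B3 H3] [B4 H4].
  exists (Num.max (Num.max B1 B2) (Num.max B3 B4)) => w [/andP[xw wx] /andP[yw wy]].
  rewrite !le_max; have [w1|/ltW w1] := leP (complex.Re w) (x1 + s1 / 2);
    have [w2|/ltW w2] := leP (complex.Im w) (y1 + s1 / 2).
  - by rewrite H1 //; split; apply/andP; split; lra.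
  - by rewrite (H3 w) ?orbT //; split; apply/andP; split; lra.
  - by rewrite (H2 w) ?orbT //; split; apply/andP; split; lra.
  - by rewrite (H4 w) ?orbT //; split; apply/andP; split; lra.
move=> z /loc[d d0 [B HB]]; exists (d / 2); first by lra.
move=> x1 y1 s1 /andP[s1_gt0 s1d] zs; exists B => w ws; apply: HB.
by have := in_square_dist zs ws; lra.
Qed.

Lemma derivable_locally_lipschitz f z : derivable f z 1 -> exists K : R,
  exists2 d : R, 0 < d & forall w, nrm (w - z) < d -> nrm (f w - f z) <= K * nrm (w - z).
Proof.
move=> /derivable_nrmP[D DP]; have [d d0 dP] := DP 1 ltr01.
exists (1 + nrm D), d => // w wz; have := dP _ wz.
rewrite (_ : z + (w - z) = w); last by rewrite addrC subrK.
have := nrm_le_dist (f w - f z) ((w - z) *: D); rewrite nrmZ; lra.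
Qed.

Lemma derivable_locally_bounded f z : derivable f z 1 ->
  exists2 d : R, 0 < d & exists B : R, forall w, nrm (w - z) < d -> nrm (f w) <= B.
Proof.
move=> /derivable_locally_lipschitz[K [d d0 dP]].
exists d => //; exists (nrm (f z) + `|K| * d) => w wz.
have := nrm_le_dist (f w) (f z); have := dP _ wz.
have : K * nrm (w - z) <= `|K| * d.
  apply: (@le_trans _ _ (`|K| * nrm (w - z))); first by rewrite ler_wpM2r ?nrm_ge0 // ler_norm.
  by rewrite ler_wpM2l // ltW.
lra.
Qed.

Lemma derivable_invB (z w : C) : w != z -> derivable (fun u : C => (u - z)^-1 : C) w 1.
Proof.
move=> wz; apply: (@derivableV _ _ (fun u : C => u - z)); first by rewrite subr_eq0.
by apply: derivableB; [exact: derivable_id | exact: derivable_cst].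
Qed.

(* [F(w) - F(z)] / (w - z) is bounded and differentiable off z, so that its     *)
(* midpoint sums tend to 0, while those of 1 / (w - z) have norm at least 4.    *)
Lemma cauchy_bound F a b s (M : R) : 0 < s ->
  (forall w, in_square (a - s / 2) (b - s / 2) s w -> derivable F w 1) ->
  (forall w, on_boundary (a - s / 2) (b - s / 2) s w -> nrm (F w) <= M) ->
  nrm (F (a +i* b)) <= 2 * M.
Proof.
move=> s0 dF FM; set z : C := a +i* b; pose H w := (w - z)^-1 *: (F w - F z).
have s2 : 0 < s / 2 by lra.
have zsq : in_square (a - s / 2) (b - s / 2) s z by split; apply/andP; split=> /=; lra.
have dH w : in_square (a - s / 2) (b - s / 2) s w -> w <> z -> derivable H w 1.
  move=> ws /eqP wz; apply: derivable_scale; first exact: derivable_invB.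
  by apply: derivableB; [exact: dF | exact: derivable_cst].
have [B HB] : exists B, forall w, in_square (a - s / 2) (b - s / 2) s w -> nrm (H w) <= B.
  apply: bounded_on_square => // w ws; case: (pselect (w = z)) => [->|wz]; last first.
    by apply: derivable_locally_bounded; exact: dH.
  have [K [d d0 dP]] := derivable_locally_lipschitz (dF z zsq).
  exists d => //; exists `|K| => u uz; rewrite nrmZ nrmV.
  have [->|/eqP u0] := eqVneq u z; first by rewrite subrr nrm0 invr0 mul0r.
  have up : 0 < nrm (u - z) by apply: nrm_gt0 => /subr0_eq.
  rewrite ler_pdivrMl // mulrC; apply: le_trans (dP _ uz) _.
  by rewrite ler_wpM2r ?nrm_ge0 // ler_norm.
have cH := contour_cvg0_hole s0 dH HB.
suff : 4 * nrm (F z) <= 8 * M by lra.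
apply/ler_addgt0Pr => e /cH[N /(_ N (leqnn N)) NP].
have c1 : contour (fun w => (w - z)^-1 *: F w) N (a - s / 2) (b - s / 2) s =
    contour H N (a - s / 2) (b - s / 2) s +
    (contour (fun w : C => (w - z)^-1 : C) N (a - s / 2) (b - s / 2) s : R[i]) *: F z.
  rewrite -contour_scalel; apply/eqP; rewrite -subr_eq -contourB; apply/eqP; congr contour.
  by apply/funext => w; rewrite /H scalerBr.
have k4 := contour_kernel a b N s0.
have c2 : nrm (contour (fun w => (w - z)^-1 *: F w) N (a - s / 2) (b - s / 2) s) <= 8 * M.
  (* On the boundary |w - z| >= s / 2, so the integrand is at most (2 / s) M, and the perimeter is 4
     s. *)
  rewrite (_ : 8 * M = 4 * s * (2 / s * M)); last by field; rewrite gt_eqF.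
  apply: contour_bound; first exact: ltW.
  move=> w wb; rewrite nrmZ nrmV; have [[/andP[w1 w2] /andP[w3 w4]] wb4] := wb.
  apply: ler_pM; rewrite ?invr_ge0 ?nrm_ge0 //; last exact: FM.
  rewrite -[2 / s]invf_div lef_pV2 ?posrE //; last first.
    apply: nrm_gt0 => /subr0_eq wz; move: w1 w2 w3 w4 wb4; rewrite wz /= => ? ? ? ?.
    by case=> ?; lra.
  have := nrm_Re (w - z); have := nrm_Im (w - z).
  have -> : complex.Re (w - z) = complex.Re w - a by case: (w).
  have -> : complex.Im (w - z) = complex.Im w - b by case: (w).
  rewrite !ler_norml => /andP[i1 i2] /andP[r1 r2].
  by clear - wb4 i1 i2 r1 r2 s2; case: wb4 => ?; lra.
have : 4 * nrm (F z) <=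
    nrm ((contour (fun w : C => (w - z)^-1 : C) N (a - s / 2) (b - s / 2) s : R[i]) *: F z).
  by rewrite nrmZ ler_wpM2r ?nrm_ge0.
move: c2; rewrite c1; set p := contour H _ _ _ _; set q := _ *: F z.
have := nrm_le_dist q (p + q); rewrite opprD addrCA subrr addr0 nrmN.
move: NP; rewrite -/p; lra.
Qed.

(* Cauchy's estimate at z for w |-> (w - p)^-n f(w), which is differentiable at *)
(* p as well since f vanishes there: |w - p| >= 3 |z - p| on the boundary of     *)
(* the square of side 8 |z - p| centered at z, so that |f(z)| <= 2 B / 3^n.      *)
Lemma identity_propagation f (p : C) (rho d : R) : 0 < d ->
  (forall w, nrm (w - p) < rho -> derivable f w 1) ->
  (forall w, nrm (w - p) < d -> f w = 0) ->
  forall w, nrm (w - p) < rho / 10 -> f w = 0.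
Proof.
move=> d0 df f0 z zp; have [->|/eqP zp0] := eqVneq z p; first by rewrite f0 // subrr nrm0.
set r := nrm (z - p) in zp *; have r0 : 0 < r by apply: nrm_gt0 => /subr0_eq.
set a := complex.Re z; set b := complex.Im z.
have zE : z = a +i* b by rewrite /a /b; case: (z).
(* The square stays within 8 r of z, hence within 9 r < rho of p; this is why the conclusion has rho
   / 10. *)
pose s := 8 * r; have s0 : 0 < s by rewrite mulr_gt0.
have sE : s = 8 * r by [].
have zsq : in_square (a - s / 2) (b - s / 2) s z.
  by split; apply/andP; split; rewrite -/a -/b; lra.
have wz w : in_square (a - s / 2) (b - s / 2) s w -> nrm (w - z) <= s.
  move=> [/andP[w1 w2] /andP[w3 w4]]; apply: le_trans (nrm_le_ReIm _) _.
  have -> : complex.Re (w - z) = complex.Re w - a by rewrite /a; case: (w) (z) => ? ? [? ?].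
  have -> : complex.Im (w - z) = complex.Im w - b by rewrite /b; case: (w) (z) => ? ? [? ?].
  have : `|complex.Re w - a| <= s / 2 by rewrite ler_norml; apply/andP; split; lra.
  have : `|complex.Im w - b| <= s / 2 by rewrite ler_norml; apply/andP; split; lra.
  lra.
have win w : in_square (a - s / 2) (b - s / 2) s w -> nrm (w - p) < rho.
  by move=> /wz ?; have := nrm_dist_tri w z p; rewrite -/r; lra.
have [B HB] : exists B, forall w, in_square (a - s / 2) (b - s / 2) s w -> nrm (f w) <= B.
  by apply: bounded_on_square => // w /win/df; exact: derivable_locally_bounded.
pose F n w := (w - p)^-1 ^+ n *: f w.
have FS n : F n.+1 = fun w => (w - p)^-1 *: F n w.
  by apply/funext => w; rewrite /F exprS scalerA.
have dF n w : nrm (w - p) < rho -> derivable (F n) w 1.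
  move=> wrho; have [->|wp] := eqVneq w p.
    apply: (@derivable_eq_near _ _ _ (fun=> 0) _ _ d0) => [u /f0 fu0|]; last exact: derivable_cst.
    by rewrite /F fu0 scaler0.
  elim: n => [|n IH]; last by rewrite FS; apply: derivable_scale IH; exact: derivable_invB.
  rewrite (_ : F 0%N = f); first exact: df.
  by apply/funext => u; rewrite /F expr0 scale1r.
have bd n : nrm (F n z) <= 2 * (B / (3 * r) ^+ n).
  rewrite {1}zE; apply: (cauchy_bound s0) => [w /win/dF //|w [ws wb]].
  rewrite /F nrmZ nrmX nrmV mulrC ler_pM ?nrm_ge0 ?HB // ?exprn_ge0 ?invr_ge0 ?nrm_ge0 //.
  have r3 : 0 < 3 * r by lra.
  rewrite -exprVn lerXn2r ?nnegrE ?invr_ge0 ?nrm_ge0 ?(ltW r3) //.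
  have : 4 * r <= nrm (w - z).
    move: ws => [/andP[w1 w2] /andP[w3 w4]]; have := nrm_Re (w - z); have := nrm_Im (w - z).
    have -> : complex.Re (w - z) = complex.Re w - a by rewrite /a; case: (w) (z) => ? ? [? ?].
    have -> : complex.Im (w - z) = complex.Im w - b by rewrite /b; case: (w) (z) => ? ? [? ?].
    rewrite !ler_norml => /andP[i1 i2] /andP[r1 r2].
    by clear - wb i1 i2 r1 r2 sE; case: wb => ?; lra.
  have := nrm_dist_tri w p z; rewrite (nrmB p) -/r => ? ?.
  have w3 : 3 * r <= nrm (w - p) by lra.
  by rewrite lef_pV2 // posrE (lt_le_trans r3).
apply: nrm0_eq0; apply/eqP; rewrite eq_le nrm_ge0 andbT.
have B0 : 0 <= B by apply: le_trans (nrm_ge0 _) (HB z zsq).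
apply: (@geometric_le0 _ _ (2 * B)) => n; have := bd n.
rewrite /F nrmZ nrmX nrmV -/r exprVn ler_pdivrMl ?exprn_gt0 // => /le_trans; apply.
have -> : r ^+ n * (2 * (B / (3 * r) ^+ n)) = 2 * B / 3 ^+ n.
  by rewrite exprMn; field; rewrite !expf_neq0 // gt_eqF.
rewrite ler_wpM2l ?mulr_ge0 // lef_pV2 ?posrE ?exprn_gt0 // lerXn2r ?nnegrE //.
by rewrite ler_nat.
Qed.

(** A chain of discs along the segment from c to z. Discs of radius r = rho - |z - c| around its
    points stay inside the given disc, so zeros propagate over r / 10 each time, and the N steps are
    shorter than that. *)
Lemma identity_at_center f (c : C) (rho d : R) : 0 < d ->
  (forall w, nrm (w - c) < rho -> derivable f w 1) ->
  (forall w, nrm (w - c) < d -> f w = 0) ->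
  forall w, nrm (w - c) < rho -> f w = 0.
Proof.
move=> d0 df f0 z zr; set r := rho - nrm (z - c); have r0 : 0 < r by rewrite subr_gt0.
pose N := (Num.truncn (10 * nrm (z - c) / r)).+1.
have N0 : 0 < N%:R :> R by rewrite ltr0n.
have Nr : nrm (z - c) / N%:R < r / 10.
  rewrite ltr_pdivrMr //; have : 10 * nrm (z - c) / r < N%:R by apply: truncnS_gt.
  by rewrite ltr_pdivrMr //; lra.
pose q k : C := c + (k%:R / N%:R)%:C * (z - c).
have qd k w : (k <= N)%N -> nrm (w - q k) < r -> nrm (w - c) < rho.
  move=> kN wq; have := nrm_dist_tri w (q k) c.
  have -> : q k - c = (k%:R / N%:R)%:C * (z - c) by rewrite /q addrAC subrr add0r.
  rewrite nrmM nrmC ger0_norm ?divr_ge0 //.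
  have : k%:R / N%:R * nrm (z - c) <= 1 * nrm (z - c).
    by rewrite ler_wpM2r ?nrm_ge0 // ler_pdivrMr // mul1r ler_nat.
  rewrite /r in wq *; lra.
suff near0 k : (k <= N)%N -> exists2 d' : R, 0 < d' & forall w, nrm (w - q k) < d' -> f w = 0.
  have [d' d'0 h] := near0 N (leqnn N); apply: h.
  suff -> : q N = z by rewrite subrr nrm0.
  by rewrite /q divff ?gt_eqF // -[1%:C]/(1 : R[i]) mul1r addrC subrK.
elim: k => [|k IH] kN; first by exists d => // w; rewrite /q mul0r mul0r addr0; exact: f0.
have [d' d'0 h] := IH (ltnW kN).
have z0 := identity_propagation d'0 (fun w wq => df w (qd k w (ltnW kN) wq)) h.
exists (r / 10 - nrm (z - c) / N%:R) => [|w wq]; first by rewrite subr_gt0.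
apply: z0; have := nrm_dist_tri w (q k.+1) (q k).
have -> : q k.+1 - q k = (N%:R^-1)%:C * (z - c).
  rewrite /q opprD addrACA subrr add0r -mulrBl -rmorphB /= -mulrBl -natrB // subSnn.
  by rewrite mul1r.
rewrite nrmM nrmC ger0_norm ?invr_ge0 //; lra.
Qed.

End IdentityTheorem.

(** * Chains of eigenvectors *)

Section GeometricSequences.
Variables (R : realType) (V : normedModType R[i]).
Implicit Types (x u v w : nat -> V) (lam mu : R[i]) (K c : R).

Definition geometric_bound K c x := forall k, nrm (x k) <= K * c ^+ k.

(* u = (1 - lam L)^-1 x, where L is the left shift. *)
Definition shift_resolvent lam x u := forall k, u k = x k + lam *: u k.+1.

Lemma geometric_bound_shift K c x : geometric_bound K c x ->
  geometric_bound (K * c) c (fun k => x k.+1).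
Proof. by move=> xK k; rewrite -mulrA -exprS; exact: xK. Qed.

(** The Neumann series of powers of lam L; its ratio is at most 1 / 2, whence the factor 2. *)
Lemma shift_resolvent_exists K c lam x : seq_complete V -> 0 < c -> nrm lam * c <= 2^-1 ->
  geometric_bound K c x -> exists2 u, shift_resolvent lam x u & geometric_bound (2 * K) c u.
Proof.
move=> cV c0 lc xK; pose S k n := \sum_(m < n) lam ^+ m *: x (k + m)%N.
have inc k n : nrm (S k n.+1 - S k n) <= K * c ^+ k / 2 ^+ n.
  rewrite /S big_ord_recr /= [_ + _ - _]addrAC subrr add0r nrmZ nrmX.
  apply: (@le_trans _ _ (nrm lam ^+ n * (K * c ^+ (k + n)))).
    by rewrite ler_wpM2l ?exprn_ge0 ?nrm_ge0.
  rewrite exprD (_ : _ * _ = K * c ^+ k * (nrm lam * c) ^+ n); last by rewrite exprMn; ring.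
  have K0 : 0 <= K * c ^+ k by apply: le_trans (nrm_ge0 _) (xK k).
  by rewrite ler_wpM2l // -exprVn lerXn2r ?nnegrE // mulr_ge0 ?nrm_ge0 // ltW.
have [u uP] := choice (fun k => geometric_cvg cV (inc k)).
have uK k : nrm (u k) <= 2 * K * c ^+ k.
  by have := uP k 0%N; rewrite /S big_ord0 subr0 expr0 divr1 mulrA.
exists u => [k|//]; apply/subr0_eq/nrm0_eq0/eqP; rewrite eq_le nrm_ge0 andbT.
apply: (@geometric_le0 _ _ (2 * (K * c ^+ k) + nrm lam * (2 * (K * c ^+ k.+1)))) => n.
have SE : S k n.+1 = x k + lam *: S k.+1 n.
  rewrite /S big_ord_recl /= expr0 scale1r addn0 scaler_sumr; congr (_ + _).
  by apply: eq_bigr => m _; rewrite scalerA -exprS addnS addSn.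
have := nrm_dist_tri (u k) (S k n.+1) (x k + lam *: u k.+1).
have -> : S k n.+1 - (x k + lam *: u k.+1) = lam *: (S k.+1 n - u k.+1).
  by rewrite SE opprD addrACA subrr add0r scalerBr.
rewrite nrmZ (nrmB (S k.+1 n)) => /le_trans; apply; rewrite mulrDl.
apply: lerD; last by rewrite -mulrA ler_wpM2l ?nrm_ge0 ?uP.
apply: le_trans (uP k n.+1) _; have K0 : 0 <= 2 * (K * c ^+ k).
  by rewrite mulr_ge0 //; apply: le_trans (nrm_ge0 _) (xK k).
by rewrite ler_wpM2l // lef_pV2 ?posrE ?exprn_gt0 // ler_eXn2l ?ltr1n.
Qed.

(** Uniqueness for the shift resolvent: iterating gives w_k = lam^n w_(k+n), which tends to 0. *)
Lemma shift_resolvent_eq0 K c lam w : 0 < c -> nrm lam * c <= 2^-1 -> geometric_bound K c w ->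
  (forall k, w k = lam *: w k.+1) -> forall k, w k = 0.
Proof.
move=> c0 lc wK wl k; apply/nrm0_eq0/eqP; rewrite eq_le nrm_ge0 andbT.
apply: (@geometric_le0 _ _ (K * c ^+ k)) => n.
have -> : w k = lam ^+ n *: w (k + n)%N.
  elim: n => [|n IH]; first by rewrite expr0 scale1r addn0.
  by rewrite addnS exprSr -scalerA -wl.
rewrite nrmZ nrmX; apply: (@le_trans _ _ (nrm lam ^+ n * (K * c ^+ (k + n)))).
  by rewrite ler_wpM2l ?exprn_ge0 ?nrm_ge0.
rewrite exprD (_ : _ * _ = K * c ^+ k * (nrm lam * c) ^+ n); last by rewrite exprMn; ring.
have K0 : 0 <= K * c ^+ k by apply: le_trans (nrm_ge0 _) (wK k).
by rewrite ler_wpM2l // -exprVn lerXn2r ?nnegrE // mulr_ge0 ?nrm_ge0 // ltW.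
Qed.

(* The resolvent identity for the left shift. *)
Lemma shift_resolvent_identity K1 K2 K3 c lam mu x u v w : 0 < c -> nrm lam * c <= 2^-1 ->
  geometric_bound K1 c u -> geometric_bound K2 c v -> geometric_bound K3 c w ->
  shift_resolvent lam x u -> shift_resolvent mu x v -> shift_resolvent lam (fun k => v k.+1) w ->
  forall k, u k - v k = (lam - mu) *: w k.
Proof.
move=> c0 lc uK vK wK ul vm wl k; apply/subr0_eq; move: k.
apply: (@shift_resolvent_eq0 (K1 + K2 + nrm (lam - mu) * K3) c lam) => // k.
  rewrite !mulrDl; apply: le_trans (nrmBD _ _) _; apply: lerD.
    by apply: le_trans (nrmBD _ _) _; apply: lerD; [exact: uK | exact: vK].
  by rewrite nrmZ -mulrA ler_wpM2l ?nrm_ge0 //; exact: wK.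
rewrite {1}ul {1}vm {1}wl; set a := u k.+1; set b := v k.+1; set d := w k.+1.
rewrite opprD addrACA subrr add0r scalerDr opprD addrA -[lam *: a - _ - _]addrA -opprD -scalerDl.
by rewrite [mu + _]addrC subrK -scalerBr scalerA mulrC -scalerA -scalerBr.
Qed.

End GeometricSequences.

Section Eigenchains.
Variables (R : realType) (V : normedModType R[i]) (T : {linear V -> V}).
Local Notation C := (R[i]^o).
Implicit Types (x u v w : nat -> V) (lam mu : C) (K c : R).

Definition chain x := forall k, T (x k.+1) = x k.

(** The defect T u_(k+1) - u_k solves the homogeneous equation, so it vanishes; then T u_0 = T x_0 +
    lam T u_1 = T x_0 + lam u_0. *)
Lemma shift_resolvent_chain K1 K2 c lam x u : continuous T -> 0 < c -> nrm lam * c <= 2^-1 ->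
  geometric_bound K1 c x -> chain x -> geometric_bound K2 c u -> shift_resolvent lam x u ->
  chain u /\ shift_op T lam (u 0%N) = T (x 0%N).
Proof.
move=> cT c0 lc xK xc uK ul; have [B B0 TB] := (linear_continuousP T).1 cT.
have uc : chain u.
  move=> k; apply/subr0_eq; move: k.
  apply: (@shift_resolvent_eq0 _ _ (B * (K2 * c) + K2) c lam) => // k.
    rewrite mulrDl; apply: le_trans (nrmBD _ _) _; apply: lerD; last exact: uK.
    by apply: le_trans (TB _) _; rewrite -mulrA ler_wpM2l ?(ltW B0) // -mulrA -exprS.
  rewrite {1}ul [u k in LHS]ul linearD xc linearZ opprD addrACA subrr add0r.
  by rewrite -scalerBr.
by split=> //; rewrite /shift_op {1}ul linearD linearZ uc addrK.
Qed.

Record eigenchain c x : Prop := {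
  eigenchain_gt0 : 0 < c ;
  eigenchain_neq0 : x 0%N <> 0 ;
  eigenchain_eigen : T (x 0%N) = 0 ;
  eigenchain_chain : chain x ;
  eigenchain_bound : geometric_bound (nrm (x 0%N)) c x }.

(** With R = (1 - lam L)^-1, the vectors y_j are the initial terms of R x, R L R x, R L R L R x, and
    so on: T - lam sends the initial term of R v to T v_0, which for v = L Y_j is the initial term
    of Y_j. *)
Lemma jordan_chain c x lam : seq_complete V -> continuous T -> eigenchain c x ->
  nrm lam * c <= 4^-1 -> exists y : nat -> V, [/\ y 0%N <> 0,
    shift_op T lam (y 0%N) = 0 & forall j, shift_op T lam (y j.+1) = y j].
Proof.
move=> cV cT [c0 x0 Tx0 xc xK] lc4; have lc : nrm lam * c <= 2^-1 by lra.
(* The choice of u does not depend on K; uniqueness transfers every bound on v to it. *)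
have step v : exists u, forall K, geometric_bound K c v -> chain v ->
    [/\ geometric_bound (2 * K) c u, shift_resolvent lam v u, chain u &
      shift_op T lam (u 0%N) = T (v 0%N)].
  case: (pselect (exists K, geometric_bound K c v /\ chain v)) => [[K0 [vK0 vc]]|nv]; last first.
    by exists (fun=> 0) => K vK vc; case: nv; exists K.
  have [u ul uK0] := shift_resolvent_exists cV c0 lc vK0.
  have [uc u0] := shift_resolvent_chain cT c0 lc vK0 vc uK0 ul.
  exists u => K vK _; split=> //; have [u' u'l u'K] := shift_resolvent_exists cV c0 lc vK.
  suff -> : u = u' by [].
  apply/funext => k; apply/subr0_eq; move: k.
  apply: (@shift_resolvent_eq0 _ _ (2 * K0 + 2 * K) c lam) => // k.
    by rewrite mulrDl; apply: le_trans (nrmBD _ _) _; apply: lerD.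
  by rewrite {1}ul {1}u'l opprD addrACA subrr add0r scalerBr.
have [g gP] := choice step.
pose Y j := iter j (fun v => g (fun k => v k.+1)) (g x).
have YP j : exists K, geometric_bound K c (Y j) /\ chain (Y j).
  elim: j => [|j [K [YK Yc]]]; first by have [uK _ uc _] := gP x _ xK xc; exists (2 * nrm (x 0%N)).
  have [uK _ uc _] := gP _ _ (geometric_bound_shift YK) (fun k => Yc k.+1).
  by exists (2 * (K * c)).
exists (fun j => Y j 0%N); split=> [||j].
(* If y_0 = 0 then x_0 = - lam u_1 with |u_1| <= 2 |x_0| c, so |x_0| <= |x_0| / 2. *)
- have [uK ul _ _] := gP x _ xK xc; rewrite -[Y 0%N]/(g x) => g0.
  have := ul 0%N; rewrite g0 => /eqP; rewrite eq_sym addr_eq0 => /eqP xE.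
  have := nrmN (x 0%N); rewrite {1}xE opprK nrmZ.
  have := uK 1%N; rewrite expr1 => u1; have xp := nrm_gt0 x0 => e.
  have : nrm lam * nrm (g x 1%N) <= nrm lam * (2 * nrm (x 0%N) * c) by rewrite ler_wpM2l ?nrm_ge0.
  have : nrm lam * c * nrm (x 0%N) <= 4^-1 * nrm (x 0%N) by rewrite ler_wpM2r ?nrm_ge0.
  lra.
- by have [_ _ _ ->] := gP x _ xK xc.
have [K [YK Yc]] := YP j.
by have [_ _ _ ->] := gP _ _ (geometric_bound_shift YK) (fun k => Yc k.+1); exact: Yc.
Qed.

(** The solution is f(lam) = sum_k lam^k x_k, the initial term of R_lam x. Two uses of the resolvent
    identity give its derivative at mu, the initial term of R_mu L R_mu x, with a remainder h^2 q_0
    bounded uniformly in h. *)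
Lemma eigenchain_not_SVEP c x : seq_complete V -> continuous T -> eigenchain c x -> ~ SVEP T 0.
Proof.
move=> cV cT [c0 x0 Tx0 xc xK] svep; pose r := 4^-1 / c.
have r0 : 0 < r by rewrite divr_gt0.
have inr lam : nrm lam < r -> nrm lam * c <= 2^-1 by rewrite ltr_pdivlMr //; lra.
have pick (lam : C) : exists u, nrm lam < r ->
    shift_resolvent lam x u /\ geometric_bound (2 * nrm (x 0%N)) c u.
  case: (pselect (nrm lam < r)) => [lr|]; last by exists (fun=> 0).
  by have [u ? ?] := shift_resolvent_exists cV c0 (inr _ lr) xK; exists u.
have [f fP] := choice pick.
have ballr lam : ball (0 : C) r%:C lam -> nrm lam < r.
  by rewrite -ball_normE /ball_ /= nrm_lt sub0r nrmN.
have := svep r%:C _ (fun lam => f lam 0%N).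
rewrite ltcR => /(_ r0) H; apply: x0; have f0 : nrm (0 : C) < r by rewrite nrm0.
have -> : x 0%N = f 0 0%N by have [-> _] := fP _ f0; rewrite scale0r addr0.
apply: H => [mu /ballr mur | lam /ballr lr |]; last first.
- by rewrite -ball_normE /ball_ /= nrm_lt subrr nrm0.
- have [fl fK] := fP _ lr.
  by have [_ ->] := shift_resolvent_chain cT c0 (inr _ lr) xK xc fK fl.
have [fm fmK] := fP _ mur; have fmS := geometric_bound_shift fmK.
have [z zl zK] := shift_resolvent_exists cV c0 (inr _ mur) fmS.
have zS := geometric_bound_shift zK.
set K4 := 2 * (2 * (2 * nrm (x 0%N) * c) * c) in zS *.
apply/derivable_nrmP; exists (z 0%N) => e e0.
have K40 : 0 <= K4 by rewrite /K4; do ![rewrite mulr_ge0 ?nrm_ge0 ?(ltW c0) //].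
exists (Num.min (r - nrm mu) (e / (K4 + 1))) => [|h].
  by rewrite lt_min subr_gt0 mur divr_gt0 // ltr_wpDl.
rewrite lt_min => /andP[hr he].
have lr : nrm (mu + h) < r by have := nrmD mu h; lra.
have [fl flK] := fP _ lr.
have [w wl wK] := shift_resolvent_exists cV c0 (inr _ lr) fmS.
have [q ql qK] := shift_resolvent_exists cV c0 (inr _ lr) zS.
have e1 := shift_resolvent_identity c0 (inr _ lr) flK fmK wK fl fm wl 0%N.
have e2 := shift_resolvent_identity c0 (inr _ lr) wK zK qK wl zl ql 0%N.
have hE : mu + h - mu = h by rewrite addrAC subrr add0r.
rewrite e1 hE -scalerBr e2 hE !nrmZ mulrC ler_wpM2r ?nrm_ge0 //.
have := qK 0%N; rewrite expr0 mulr1 => q0.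
have q0' : nrm (q 0%N) <= K4 + 1 by rewrite /K4; lra.
apply: le_trans (ler_wpM2l (nrm_ge0 h) q0') _.
by rewrite -ler_pdivlMr ?ltW // ltr_wpDl.
Qed.

Lemma eigenchain_not_bounded_below c x lam : seq_complete V -> continuous T -> eigenchain c x ->
  nrm lam * c <= 4^-1 -> ~ bounded_below (shift_op T lam).
Proof.
move=> cV cT xc lc [k k0 kP]; have [y [y0 Ty0 _]] := jordan_chain cV cT xc lc.
apply: y0; apply: nrm0_eq0; apply/eqP; rewrite eq_le nrm_ge0 andbT -lecR -nrmE.
by have := kP (y 0%N); rewrite Ty0 normr0 pmulr_rle0.
Qed.

(** An infinite Jordan chain lies in the range of every power of S = T - lam, and y_p is in
    N(S^(p+1)) but not in N(S^p), so no restriction to such a range has finite ascent. *)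
Lemma eigenchain_not_BBrowder c x lam : seq_complete V -> continuous T -> eigenchain c x ->
  nrm lam * c <= 4^-1 -> ~ upper_semi_B_Browder (shift_op T lam).
Proof.
move=> cV cT xc lc [n [W [TW [WE _ [_ [p ap]]]]]].
have [y [y0 Ty0 yS]] := jordan_chain cV cT xc lc.
set S := shift_op T lam in TW WE ap Ty0 yS *.
have yn k j : iter k S (y (j + k)%N) = y j.
  by elim: k j => [|k IH] j; rewrite ?addn0 // addnS iterSr yS.
have yW j : y j \in W.
  suff : [set` W] (y j) by [].
  by rewrite WE; exists (y (j + n)%N).
pose yp : subspaceType W := exist _ (y p) (yW p).
have val_iter k (a : subspaceType W) : val (iter k (restr TW) a) = iter k S (val a).
  by elim: k => //= k <-.
have := yn p 0%N; rewrite add0n => yp0.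
have : nullspace (iter p.+1 (restr TW)) yp.
  by apply: val_inj; rewrite val_iter /= yp0.
by rewrite -ap => /(congr1 val); rewrite val_iter /= yp0.
Qed.

End Eigenchains.

(** * Kato operators *)

Section LinearInstances.
Variables (R : realType) (V : normedModType R[i]).

Lemma iter_is_linear (T : {linear V -> V}) n : linear (iter n T).
Proof. by elim: n => [|n IH] a x y //=; rewrite IH linearP. Qed.

HB.instance Definition _ (T : {linear V -> V}) n :=
  GRing.isLinear.Build R[i] V V _ (iter n T) (iter_is_linear T n).

Lemma shift_op_is_linear (T : {linear V -> V}) lam : linear (shift_op T lam).
Proof.
move=> a x y; rewrite /shift_op linearP scalerDr opprD addrACA scalerBr.
by rewrite !scalerA mulrC.
Qed.

HB.instance Definition _ (T : {linear V -> V}) lam :=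
  GRing.isLinear.Build R[i] V V _ (shift_op T lam) (shift_op_is_linear T lam).

Lemma restr_is_linear (W : submodClosed V) (T : {linear V -> V}) (TW : invariant_subspace W T) :
  linear (restr TW).
Proof. by move=> a x y; apply: val_inj; rewrite /= linearP. Qed.

HB.instance Definition _ (W : submodClosed V) (T : {linear V -> V}) (TW : invariant_subspace W T) :=
  GRing.isLinear.Build R[i] (subspaceType W) (subspaceType W) _ (restr TW) (restr_is_linear TW).

Lemma restr_continuous (W : submodClosed V) (T : {linear V -> V}) (TW : invariant_subspace W T) :
  continuous T -> continuous (restr TW).
Proof.
move=> /linear_continuousP[K K0 TK]; apply/(linear_continuousP (restr TW)).
by exists K => // x; exact: TK.
Qed.

Lemma shift_op_continuous (T : {linear V -> V}) lam : continuous T -> continuous (shift_op T lam).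
Proof.
move=> /linear_continuousP[K K0 TK]; apply/(linear_continuousP (shift_op T lam)).
exists (K + nrm lam) => [|x]; first by rewrite ltr_wpDr ?nrm_ge0.
by rewrite mulrDl -nrmZ; apply: le_trans (nrmBD _ _) _; rewrite lerD2r.
Qed.

End LinearInstances.

Section Kato.
Variables (R : realType) (V : normedModType R[i]) (T : {linear V -> V}).

(* If T x = y with y in every R(T^n), so is x: y = T^(n+1) w gives              *)
(* x - T^n w in N(T), which is contained in R(T^n).                             *)
Lemma Kato_eigenchain (x0 : V) : seq_complete V -> continuous T -> Kato T ->
  x0 <> 0 -> T x0 = 0 -> exists c x, eigenchain T c x.
Proof.
move=> cV cT [clT kerT] x00 Tx0; have [c c0 cP] := open_mapping cV cV cT clT.
pose hyperrange y := forall n, range (iter n T) y.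
have step y : exists x, hyperrange y -> [/\ hyperrange x, T x = y & nrm x <= c * nrm y].
  case: (pselect (hyperrange y)) => [hy|]; last by exists 0.
  have [z _ zy] := hy 1%N; have [x xz xc] := cP z; rewrite -[T z]/(iter 1 T z) zy in xz xc.
  exists x => _; split=> // n; have [w _ wy] := hy n.+1.
  have [|w' _ w'E] := kerT n (x - iter n T w); first by rewrite /nullspace /= linearB xz -wy subrr.
  by exists (w + w') => //; rewrite linearD /= w'E addrC subrK.
have [g gP] := choice step; have hx k : hyperrange (iter k g x0).
  elim: k => [|k /gP[]//] n; apply: kerT; exact: Tx0.
exists c, (fun k => iter k g x0); split=> // [k|k].
  by have [] := gP _ (hx k).
elim: k => [|k IH]; first by rewrite expr0 mulr1.
have [_ _ /le_trans] := gP _ (hx k); apply.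
by rewrite exprS mulrCA ler_pM2l.
Qed.

Lemma eigenchain_subspace (W : submodClosed V) (TW : invariant_subspace W T) c x :
  eigenchain (restr TW) c x -> eigenchain T c (fun k => val (x k)).
Proof.
move=> [c0 x0 Tx0 xc xK]; split=> //.
- by move=> h; apply: x0; apply: val_inj.
- by have /(congr1 val) := Tx0.
- by move=> k; have /(congr1 val) := xc k.
Qed.

Lemma Kato_injective_bounded_below : seq_complete V -> continuous T -> Kato T ->
  (forall x, T x = 0 -> x = 0) -> bounded_below T.
Proof.
move=> cV cT [clT _] injT; have [c c0 cP] := injective_closed_range_bounded_below cV cV cT clT injT.
exists c%:C => [|x]; first by rewrite ltcR.
by rewrite !nrmE -rmorphM lecR.
Qed.

Lemma bounded_below_nrmP (S : V -> V) : bounded_below S <->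
  exists2 c : R, 0 < c & forall x, c * nrm x <= nrm (S x).
Proof.
split=> [[c c0 cP]|[c c0 cP]].
  have [c0' cE] := gt0C c0; exists (complex.Re c) => // x.
  by rewrite -lecR rmorphM /= -cE -!nrmE.
by exists c%:C => [|x]; rewrite ?ltcR // !nrmE -rmorphM lecR.
Qed.

Lemma bounded_below_closed_image (A : set V) (c : R) : seq_complete V -> continuous T -> closed A ->
  0 < c -> (forall x, A x -> forall y, A y -> c * nrm (x - y) <= nrm (T x - T y)) -> closed (T @` A).
Proof.
move=> cV /linear_continuousP[K K0 TK] /closed_seq clA c0 cP; apply/closed_seq => u y uT uy.
have pick n : exists x, A x /\ T x = u n by have [x] := uT n; exists x.
have [v vP] := choice pick.
have [|x vx] := cV v.
  move=> e e0; have [N NP] := uy (c * e / 2) ltac:(by rewrite divr_gt0 ?mulr_gt0).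
  exists N => m n mN nN; have [Am Tm] := vP m; have [An Tn] := vP n.
  rewrite -(ltr_pM2l c0); apply: le_lt_trans (cP _ Am _ An) _; rewrite Tm Tn.
  by have := nrm_dist_tri (u m) y (u n); rewrite (nrmB y); have := NP m mN; have := NP n nN; lra.
exists x; first by apply: clA vx => n; have [] := vP n.
apply: (converges_to_unique _ uy) => e e0.
have [N NP] := vx (e / K) ltac:(by rewrite divr_gt0).
exists N => n nN; have [_ <-] := vP n; rewrite -linearB.
by apply: le_lt_trans (TK _) _; rewrite mulrC -ltr_pdivlMr // NP.
Qed.

Lemma bounded_below_Kato : seq_complete V -> continuous T -> bounded_below T -> Kato T.
Proof.
move=> cV cT /bounded_below_nrmP[c c0 cP]; split.
  apply: (bounded_below_closed_image cV cT closedT c0) => x _ y _.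
  by rewrite -linearB.
move=> n x /= Tx0; have := cP x; rewrite Tx0 nrm0 pmulr_rle0 // => x0.
exists 0 => //; rewrite linear0; apply/esym/nrm0_eq0/eqP.
by rewrite eq_le x0 nrm_ge0.
Qed.

End Kato.

(** * Poles of the resolvent *)

Section Pole.
Variables (R : realType) (V : normedModType R[i]) (T : {linear V -> V}).
Local Notation C := (R[i]^o).

Lemma le0_of_small (a b d : R) : 0 < d -> (forall t, 0 < t < d -> a <= t * b) -> a <= 0.
Proof.
move=> d0 H; apply: (@geometric_le0 _ _ (Num.min (d / 2) 1 * `|b|)) => k.
have m0 : 0 < Num.min (d / 2) 1 by rewrite lt_min ltr01 divr_gt0.
have p0 : 0 < (2 ^+ k : R)^-1 by rewrite invr_gt0 exprn_gt0.
have p1 : (2 ^+ k : R)^-1 <= 1 by rewrite invf_le1 ?exprn_gt0 // exprn_ege1 // ler1n.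
have mp : Num.min (d / 2) 1 / 2 ^+ k <= Num.min (d / 2) 1 by rewrite ler_piMr // ltW.
have md : Num.min (d / 2) 1 <= d / 2 by rewrite ge_min lexx.
have t0 : 0 < Num.min (d / 2) 1 / 2 ^+ k < d.
  by rewrite mulr_gt0 //=; lra.
by apply: le_trans (H _ t0) _; rewrite mulrAC ler_wpM2r ?(ltW p0) // ler_wpM2l ?(ltW m0) // ler_norm.
Qed.

Lemma bounded_op_nrm (S : V -> V) : bounded_op S ->
  exists2 K : R, 0 < K & forall x, nrm (S x) <= K * nrm x.
Proof.
move=> [lS cS]; pose S' : {linear V -> V} := HB.pack S (GRing.isLinear.Build R[i] V V _ S lS).
exact: (linear_continuousP S').1 cS.
Qed.

(** Here k = mu - lam and q + 1 is the order of the pole. Differentiability in operator norm at lam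
    bounds G(k) - G(0), hence G(k), uniformly in y. The last two clauses are the two resolvent
    equations cleared of denominators, and d <= 1 gives |k|^(q+1) <= |k|. *)
Lemma pole_data lam : resolvent_pole T lam -> exists q (G : C -> V -> V) (d K : R),
  [/\ 0 < d <= 1, 0 < K,
    [/\ forall x y, G 0 (x - y) = G 0 x - G 0 y,
      forall y k, nrm k < d -> derivable (fun k => G k y) k 1,
      forall y k, nrm k < d -> nrm (G k y) <= K * nrm y &
      forall y k, nrm k < d -> nrm (G k y - G 0 y) <= K * nrm k * nrm y],
    forall y k, k != 0 -> nrm k < d ->
      shift_op T lam (G k y) = k *: G k y + k ^+ q.+1 *: y &
    forall y k, k != 0 -> nrm k < d ->
      G k (shift_op T lam y) = k *: G k y + k ^+ q.+1 *: y].
Proof.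
move=> [_ [p [G [p0 /near_nrm[d1 d10 G1] _ /near_dnbhs_nrm[d2 d20 G2]]]]].
case: p p0 G2 => // q _ G2.
have shiftE k (x : V) : shift_op T (lam + k) x = shift_op T lam x - k *: x.
  by rewrite /shift_op scalerDl opprD addrA.
have lamk k : nrm (lam - (lam + k)) = nrm k by rewrite opprD addrA subrr add0r nrmN.
have dG y k : nrm k < d1 -> derivable (fun k => G (lam + k) y) k 1.
  move=> kd; have [|_ [D _ DP]] := G1 (lam + k); first by rewrite lamk.
  apply/cvg_ex; exists (D y); apply/cvgrPdist_lt => e e0; have [e0' eE] := gt0C e0.
  have yp : 0 < nrm y + 1 by rewrite ltr_wpDl ?nrm_ge0.
  have /near_dnbhs_nrm[r r0 rP] := DP (complex.Re e / (nrm y + 1))%:C ltac:(by rewrite ltcR divr_gt0).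
  apply/near_dnbhs_nrm; exists r => // h h0 hr; rewrite eE nrm_lt /= [_ *: 1]mulr1 nrmB.
  have := rP h h0 hr y; rewrite nrmE [X in _ <= _ * X]nrmE -rmorphM lecR.
  rewrite [h + k]addrC addrA => /le_lt_trans; apply.
  by rewrite mulrAC ltr_pdivrMr // ltr_pM2l // ltrDl.
have [|bG0 [D bD DP]] := G1 lam; first by rewrite subrr nrm0.
have [K0 K0_gt0 K0P] := bounded_op_nrm bG0; have [KD KD_gt0 KDP] := bounded_op_nrm bD.
have /near_dnbhs_nrm[d3 d30 G3] := DP 1 ltr01.
have G3' y k : nrm k < d3 -> nrm (G (lam + k) y - G lam y) <= (1 + KD) * nrm k * nrm y.
  have [->|k0] := eqVneq k 0; first by rewrite addr0 subrr !nrm0 mulr0 mul0r.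
  move=> kd; have := G3 k k0; rewrite sub0r nrmN => /(_ kd y).
  rewrite mul1r !nrmE lecR => h.
  have kp : 0 < nrm k by apply: nrm_gt0; apply/eqP.
  have -> : G (lam + k) y - G lam y = k *: (k^-1 *: (G (lam + k) y - G lam y)).
    by rewrite scalerA divff // scale1r.
  rewrite nrmZ [(1 + KD) * _]mulrC -mulrA ler_pM2l // mulrDl mul1r.
  have := nrm_le_dist (k^-1 *: (G (lam + k) y - G lam y)) (D y); have := KDP y; lra.
exists q, (fun k => G (lam + k)), (Num.min (Num.min d1 d2) (Num.min d3 1)), (K0 + (1 + KD)).
have lt4 (k : C) : nrm k < Num.min (Num.min d1 d2) (Num.min d3 1) ->
    [/\ nrm k < d1, nrm k < d2, nrm k < d3 & nrm k < 1].
  by rewrite !lt_min => /andP[/andP[-> ->] /andP[-> ->]].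
split=> [||| y k k0 /lt4[kd1 kd2 _ _] | y k k0 /lt4[kd1 kd2 _ _]].
- by rewrite !lt_min d10 d20 d30 ltr01 /= !ge_min lexx !orbT.
- by lra.
- split=> [x y | y k /lt4[kd _ _ _] | y k /lt4[_ _ kd k1] | y k /lt4[_ _ kd _]].
  + by rewrite addr0; case: bG0 => lG _; rewrite -scaleN1r addrC lG scaleN1r addrC.
  + exact: dG.
  + have := nrm_le_dist (G (lam + k) y) (G lam y); have := G3' y k kd; have := K0P y.
    have : (1 + KD) * nrm k * nrm y <= (1 + KD) * 1 * nrm y.
      by rewrite ler_wpM2r ?nrm_ge0 // ler_wpM2l //; lra.
    lra.
  rewrite addr0; apply: le_trans (G3' y k kd) _; rewrite ler_wpM2r ?nrm_ge0 //.
  rewrite ler_wpM2r ?nrm_ge0 //; lra.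
- have [||_ _] := G2 (lam + k); rewrite ?lamk //.
    by rewrite -subr_eq0 addrAC subrr add0r.
  move=> /(_ (k ^+ q.+1 *: y)); rewrite [lam + k - lam]addrAC subrr add0r.
  have [[lG _] _] := G1 (lam + k) ltac:(by rewrite lamk).
  have -> : G (lam + k) (k ^+ q.+1 *: y) = k ^+ q.+1 *: G (lam + k) y.
    by rewrite -[k ^+ _ *: y]addr0 lG (_ : G (lam + k) 0 = 0) ?addr0 //;
      have := lG (-1) 0 0; rewrite scaler0 addr0 scaleN1r addNr.
  rewrite scalerA mulVf ?expf_neq0 // scale1r shiftE => <-.
  by rewrite [RHS]addrC subrK.
have [||_ + _] := G2 (lam + k); rewrite ?lamk //.
  by rewrite -subr_eq0 addrAC subrr add0r.
move=> /(_ y); rewrite [lam + k - lam]addrAC subrr add0r shiftE => e.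
have [[lG _] _] := G1 (lam + k) ltac:(by rewrite lamk).
have : k ^+ q.+1 *: y = G (lam + k) (shift_op T lam y - k *: y).
  by rewrite -[in LHS]e scalerA divff ?expf_neq0 // scale1r.
move=> ->; rewrite [_ - k *: y]addrC -scaleNr lG scaleNr.
by rewrite addrA subrr add0r.
Qed.

(* With S = T - lam, p = q + 1 and (S - k)^-1 = k^-p G(k), the function       *)
(* k |-> sum_(j < p) k^j S^(p-1-j) y + G(k) y is analytic at 0 and equals     *)
(* (S - k)^-1 S^p y elsewhere; L y is its value at 0, which Cauchy's estimate *)
(* bounds by a multiple of |S^p y|.                                           *)
Lemma pole_inverse lam : resolvent_pole T lam -> continuous T ->
  exists q (L : V -> V) (b : R), [/\ 0 < b,
    forall x y, L (x - y) = L x - L y,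
    forall y, shift_op T lam (L y) = iter q.+1 (shift_op T lam) y,
    forall y, L (shift_op T lam y) = iter q.+1 (shift_op T lam) y &
    forall y, nrm (L y) <= b * nrm (iter q.+1 (shift_op T lam) y) /\
      forall e : R, 0 < e -> exists y', nrm (iter q.+1 (shift_op T lam) y' - L y) < e].
Proof.
move=> /pole_data[q [G [d [K [/andP[d0 d1] K0 [GB dG GK Gc] SG GS]]]]] cT.
pose S : {linear V -> V} := shift_op T lam; rewrite -/S.
have {}SG (y : V) (k : C) (k0 : k != 0) (kd : nrm k < d) :
  S (G k y) = k *: G k y + k ^+ q.+1 *: y := SG y k k0 kd.
have {}GS (y : V) (k : C) (k0 : k != 0) (kd : nrm k < d) :
  G k (S y) = k *: G k y + k ^+ q.+1 *: y := GS y k k0 kd.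
have [KS KS0 SK] := (linear_continuousP S).1 (shift_op_continuous cT).
have small (t : R) : 0 < t < d -> [/\ (t%:C : C) != 0, nrm (t%:C : C) < d & nrm (t%:C : C) = t].
  move=> /andP[t0 td]; rewrite nrmC gtr0_norm // td; split=> //.
  by rewrite eq_complex /= gt_eqF.
have pow (t : R) : 0 < t < d -> t ^+ q.+1 <= t.
  by move=> /andP[t0 td]; rewrite exprS ler_piMr ?(ltW t0) // exprn_ile1 ?(ltW t0) //; lra.
(* Let k tend to 0 in G(k) S y = k G(k) y + k^(q+1) y. *)
have G0S y : G 0 (S y) = 0.
  apply/nrm0_eq0/eqP; rewrite eq_le nrm_ge0 andbT.
  apply: (@le0_of_small _ (K * nrm (S y) + K * nrm y + nrm y) d d0) => t td.
  have [k0 kd kt] := small t td; have := Gc (S y) _ kd; have := GK y _ kd.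
  rewrite nrmB kt => h1 h2; have := nrm_le_dist (G 0 (S y)) (G t%:C (S y)).
  have : nrm (G t%:C (S y)) <= t * nrm (G t%:C y) + t ^+ q.+1 * nrm y.
    by rewrite GS //; apply: le_trans (nrmD _ _) _; rewrite !nrmZ nrmX kt.
  have [t0 _] := andP td; have := ler_wpM2l (ltW t0) h1; have := ler_wpM2r (nrm_ge0 y) (pow t td).
  lra.
have SG0 y : S (G 0 y) = 0.
  apply/nrm0_eq0/eqP; rewrite eq_le nrm_ge0 andbT.
  apply: (@le0_of_small _ (KS * (K * nrm y) + K * nrm y + nrm y) d d0) => t td.
  have [k0 kd kt] := small t td; have := Gc y _ kd; have := GK y _ kd.
  rewrite nrmB kt => h1 h2; have := nrm_le_dist (S (G 0 y)) (S (G t%:C y)).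
  have := SK (G 0 y - G t%:C y); rewrite linearB.
  have : nrm (S (G t%:C y)) <= t * nrm (G t%:C y) + t ^+ q.+1 * nrm y.
    by rewrite SG //; apply: le_trans (nrmD _ _) _; rewrite !nrmZ nrmX kt.
  have [t0 _] := andP td; have := ler_wpM2l (ltW t0) h1; have := ler_wpM2r (nrm_ge0 y) (pow t td).
  have := ler_wpM2l (ltW KS0) h2; lra.
(* [P j y k] is the polynomial form of (S^j - k^j) (S - k)^-1 y. *)
pose P := fix P j (y : V) (k : C) : V := if j is i.+1 then k *: P i y k + iter i S y else 0.
have dP j y k : derivable (P j y) k 1.
  elim: j => [|j IH]; first exact: derivable_cst.
  apply: derivableD; last exact: derivable_cst.
  by apply: derivable_scale IH; exact: derivable_id.
have GSP j y k : k != 0 -> nrm k < d -> G k (iter j S y) = k ^+ j *: G k y + k ^+ q.+1 *: P j y k.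
  move=> k0 kd; elim: j => [|j IH]; first by rewrite expr0 scale1r scaler0 addr0.
  rewrite [iter _ _ _]/= GS // IH /= !scalerDr !scalerA -exprS [k * _]mulrC -!addrA.
  by rewrite -scalerA.
pose F y k := G k y + P q.+1 y k.
have FE y k : k != 0 -> nrm k < d -> k ^+ q.+1 *: F y k = G k (iter q.+1 S y).
  by move=> k0 kd; rewrite GSP // -scalerDr.
have comm j y k : k != 0 -> nrm k < d -> G k (iter j S y) = iter j S (G k y).
  by move=> k0 kd; elim: j => //= j IH; rewrite GS // -IH -SG.
pose L y := F y 0; have LE y : L y = G 0 y + iter q S y by rewrite /L /F /= scale0r add0r.
have dF y k : nrm k < d -> derivable (F y) k 1.
  by move=> kd; apply: derivableD; [exact: dG | exact: dP].
pose s := d / 4; have s0 : 0 < s by rewrite divr_gt0.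
have wd w : in_square (0 - s / 2) (0 - s / 2) s w -> nrm w < d.
  have c0 : in_square (0 - s / 2) (0 - s / 2) s (0 : R[i]) by split; apply/andP; split=> /=; lra.
  by move=> /(in_square_dist c0); rewrite subr0 /s; lra.
exists q, L, (2 * ((2 / s) ^+ q.+1 * K)); split=> [|x y|y|y|y].
- by rewrite !mulr_gt0 // exprn_gt0 // divr_gt0.
- by rewrite !LE GB linearB opprD addrACA.
- by rewrite LE linearD SG0 add0r.
- by rewrite LE G0S add0r -iterSr.
split=> [|e e0].
  rewrite /L -[0]/((0 : R) +i* (0 : R)) -mulrA.
  (* On the boundary |w| >= s / 2, and w^(q+1) F(w) = G(w) S^(q+1) y. *)
  apply: (cauchy_bound s0) => [w /wd/dF //|w [ws wb]].
  have wp : s / 2 <= nrm w.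
    have := nrm_Re w; have := nrm_Im w; rewrite !ler_norml => /andP[i1 i2] /andP[r1 r2].
    by clear - wb i1 i2 r1 r2; case: wb => ?; lra.
  have w0 : w != 0 by apply/eqP => w0; move: wp; rewrite w0 nrm0; lra.
  have wwd := wd _ ws; have := GK (iter q.+1 S y) _ wwd; rewrite -FE // nrmZ nrmX => h.
  have wn : 0 < nrm w by apply: nrm_gt0; apply/eqP.
  rewrite -(ler_pM2l (exprn_gt0 q.+1 wn)); apply: le_trans h _.
  rewrite 2!mulrA -exprMn -mulrA ler_peMl ?mulr_ge0 ?nrm_ge0 ?(ltW K0) // exprn_ege1 //.
  by rewrite mulrA ler_pdivlMr // mul1r; lra.
have [B [r r0 rP]] := derivable_locally_lipschitz (dF y 0 ltac:(by rewrite nrm0)).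
pose t := Num.min (Num.min (d / 2) (r / 2)) (e / 2 / (`|B| + 1)).
have Bp : 0 < `|B| + 1 by rewrite ltr_wpDl.
have t0 : 0 < t by rewrite !lt_min !divr_gt0.
have tb : [/\ t <= d / 2, t <= r / 2 & t <= e / 2 / (`|B| + 1)].
  by split; rewrite /t !ge_min lexx ?orbT.
have [tb1 tb2 tb3] := tb.
have [|k0 kd kt] := small t; first by rewrite t0; lra.
(* This is (S - t)^-1 y; its image under S^(q+1) is F y t, which tends to F y 0 = L y. *)
exists ((t%:C : C) ^- q.+1 *: G t%:C y).
have -> : iter q.+1 S ((t%:C : C) ^- q.+1 *: G t%:C y) = F y t%:C.
  rewrite linearZ /= -[S _]/(iter q.+1 S _) -comm // -FE // scalerA mulVf ?expf_neq0 //.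
  by rewrite scale1r.
have := rP t%:C; rewrite subr0 kt => /(_ ltac:(lra)) /le_lt_trans; apply.
apply: (@le_lt_trans _ _ ((`|B| + 1) * t)).
  by rewrite ler_wpM2r ?(ltW t0) //; have := ler_norm B; lra.
by rewrite mulrC; apply: (@le_lt_trans _ _ (e / 2)); [rewrite -ler_pdivlMr | lra].
Qed.

End Pole.

Section PoleRange.
Variables (R : realType) (V : normedModType R[i]) (T : {linear V -> V}).
Local Notation C := (R[i]^o).

(** Put p = q + 1 and S = T - lam. For x = S^p y = L (S y), the bound on L gives |x| <= b |S x|. For
    closedness, let Y be the closure of R(S^p): if S^p y_n tends to x, then L y_n is Cauchy with
    limit w in Y, and S w = x. So S maps Y onto Y, and p such lifts put x in R(S^p). *)
Lemma pole_range lam : seq_complete V -> continuous T -> resolvent_pole T lam ->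
  exists p, closed (range (iter p (shift_op T lam))) /\
    exists2 c : R, 0 < c & forall x, range (iter p (shift_op T lam)) x ->
      c * nrm x <= nrm (shift_op T lam x).
Proof.
move=> cV cT /pole_inverse/(_ cT)[q [L [b [b0 LB SL LS Lb]]]].
pose S : {linear V -> V} := shift_op T lam.
have [KS KS0 SK] := (linear_continuousP S).1 (shift_op_continuous cT).
exists q.+1; split; last first.
  exists b^-1; first by rewrite invr_gt0.
  move=> _ [y _ <-]; rewrite ler_pdivrMl // -[X in nrm X <= _]LS.
  by have [+ _] := Lb (S y); rewrite -iterSr.
pose Y x := forall e : R, 0 < e -> exists y, nrm (iter q.+1 S y - x) < e.
have lift x : Y x -> exists2 w, Y w & S w = x.
  move=> Yx; have pick n : exists y, nrm (iter q.+1 S y - x) < (2 ^+ n)^-1.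
    by apply: Yx; rewrite invr_gt0 exprn_gt0.
  have [y yP] := choice pick.
  have [|w wP] := @geometric_cvg _ _ (fun n => L (y n)) (b * 2) cV.
    move=> n; rewrite -LB; have [+ _] := Lb (y n.+1 - y n) => /le_trans; apply.
    rewrite -mulrA ler_pM2l //.
    have -> : iter q.+1 (shift_op T lam) (y n.+1 - y n) = iter q.+1 S (y n.+1) - iter q.+1 S (y n).
      exact: (linearB (iter q.+1 S)).
    have := nrm_dist_tri (iter q.+1 S (y n.+1)) x (iter q.+1 S (y n)).
    rewrite (nrmB x); have := yP n; have := yP n.+1; rewrite exprS invfM.
    have : 0 < (2 ^+ n : R)^-1 by rewrite invr_gt0 exprn_gt0.
    lra.
  exists w => [e e0|].
    have e2 : 0 < e / 2 by lra.
    have [n nP] := geometric_lt (2 * (b * 2)) e2; have [_ /(_ _ e2)[y' y'P]] := Lb (y n).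
    exists y'; have := nrm_dist_tri (iter q.+1 S y') (L (y n)) w; rewrite (nrmB (L (y n))).
    by have := wP n; move: y'P; rewrite -/S; lra.
  apply/subr0_eq/nrm0_eq0/eqP; rewrite eq_le nrm_ge0 andbT.
  apply: (@geometric_le0 _ _ (KS * (2 * (b * 2)) + 1)) => n.
  have := nrm_dist_tri (S w) (S (L (y n))) x; rewrite -[S w - S _]linearB.
  rewrite [S (L (y n))]SL; have := SK (w - L (y n)); have := ler_wpM2l (ltW KS0) (wP n).
  by have := yP n; rewrite -/S; lra.
apply/closed_seq => u x uS ux.
have Yx : Y x.
  move=> e /ux[N NP]; have [y _ yE] := uS N; exists y.
  by rewrite -[iter q.+1 S y]/(iter q.+1 (shift_op T lam) y) yE NP.
suff [w _ wx] : exists2 w, Y w & iter q.+1 S w = x by exists w.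
elim: q.+1 => [|j [w Yw wx]]; first by exists x.
by have [w' Yw' w'E] := lift w Yw; exists w' => //; rewrite iterSr w'E.
Qed.

Lemma meromorphic_resolvent_dense (mu : C) (e : R) : meromorphic T -> 0 < e ->
  exists2 mu' : C, nrm (mu' - mu) < e & ~ spectrum T mu'.
Proof.
move=> mT; suff nz (z : C) (r : R) : z != 0 -> 0 < r ->
    exists2 z' : C, nrm (z' - z) < r & ~ spectrum T z'.
  move=> e0; have [->|/nz] := eqVneq mu 0; last exact.
  have e2 : 0 < e / 2 by lra.
  have [||z zr zS] := nz (e / 2)%:C (e / 2); rewrite ?divr_gt0 //.
    by rewrite eq_complex /= gt_eqF.
  exists z => //; have := nrm_le_dist z (e / 2)%:C; rewrite nrmC gtr0_norm ?subr0; lra.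
move=> z0 r0; case: (pselect (spectrum T z)) => [Sz|nS]; last by exists z; rewrite // subrr nrm0.
have [[_ [U /near_nrm[d d0 dU] US]] _] := mT z z0 Sz.
pose t := Num.min (d / 2) (r / 2); have t0 : 0 < t by rewrite lt_min !divr_gt0.
have [td tr] : t <= d / 2 /\ t <= r / 2 by rewrite /t !ge_min !lexx orbT.
have tE : z + t%:C - z = t%:C by rewrite addrAC subrr add0r.
exists (z + t%:C); first by rewrite tE nrmC gtr0_norm //; lra.
move=> St; have : (U `&` spectrum T) (z + t%:C).
  by split=> //; apply: dU; rewrite nrmB tE nrmC gtr0_norm //; lra.
rewrite US => /eqP; rewrite -subr_eq0 tE eq_complex /= gt_eqF //.
Qed.

End PoleRange.

(** * Reducing pairs *)

Section RangeSubspace.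
Variables (R : realType) (V : normedModType R[i]) (T : {linear V -> V}).

Definition range_pred : {pred V} := fun x => `[< range T x >].

Lemma range_submod_closed : subsemimod_closed range_pred.
Proof.
split; first split; first by apply/asboolP; exists 0; rewrite ?linear0.
  by move=> _ _ /asboolP[a _ <-] /asboolP[b _ <-]; apply/asboolP; exists (a + b); rewrite ?linearD.
by move=> k _ /asboolP[a _ <-]; apply/asboolP; exists (k *: a); rewrite ?linearZ.
Qed.

HB.instance Definition _ := GRing.isSubmodClosed.Build R[i] V range_pred range_submod_closed.

Definition range_submod : submodClosed V := range_pred.

Lemma range_submodE : [set` range_submod] = range T.
Proof. by apply/seteqP; split=> x; rewrite /= unfold_in => /asboolP. Qed.

End RangeSubspace.

Section ReducingPair.
Variables (R : realType) (X : normedModType R[i]) (T : {linear X -> X}).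
Hypotheses (cX : seq_complete X) (cT : continuous T).
Variables (M N : submodClosed X) (MN : Red T M N).
Local Notation C := (R[i]^o).

Definition red_sum_map (z : (subspaceType M * subspaceType N)%type) : X := val z.1 + val z.2.

Lemma red_sum_map_linear : linear red_sum_map.
Proof. by move=> a x y; rewrite /red_sum_map /= scalerDr addrACA. Qed.

HB.instance Definition _ := GRing.isLinear.Build R[i] (subspaceType M * subspaceType N)%type X _
  red_sum_map red_sum_map_linear.

Lemma red_decomposition_unique (y y' : subspaceType M) (z z' : subspaceType N) :
  val y + val z = val y' + val z' -> y = y' /\ z = z'.
Proof.
move=> /eqP; rewrite -subr_eq0 opprD addrACA addr_eq0 => /eqP e.
have yz0 : val (y - y') = 0.
  apply: (red_cap MN); first exact: (valP (y - y')).
  rewrite [val _]e -opprB opprK -[_ - _]/(val (z' - z)); exact: (valP (z' - z)).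
have := e; rewrite -[_ - _]/(val (y - y')) yz0 => /esym/eqP; rewrite oppr_eq0 => /eqP z0.
by split; apply/subr0_eq/val_inj.
Qed.

(** The sum map M x N -> X is a continuous bijection of complete spaces, hence bounded below, and
    this bounds both components. *)
Lemma red_projections :
  exists (p : {linear X -> subspaceType M}) (q : {linear X -> subspaceType N}),
  [/\ forall x, x = val (p x) + val (q x), continuous p & continuous q].
Proof.
have pick x : exists yz : subspaceType M * subspaceType N, x = val yz.1 + val yz.2.
  have [y [z [yM zN ->]]] := red_sum MN x.
  by exists (exist _ y yM : subspaceType M, exist _ z zN : subspaceType N).
have [f fP] := choice pick.
have pl : linear (fun x => (f x).1).
  move=> a x y; have [-> _//] : (f (a *: x + y)).1 = a *: (f x).1 + (f y).1 /\
      (f (a *: x + y)).2 = a *: (f x).2 + (f y).2.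
  by apply: red_decomposition_unique; rewrite -fP /= addrACA -scalerDr -!fP.
have ql : linear (fun x => (f x).2).
  move=> a x y; have [_ ->//] : (f (a *: x + y)).1 = a *: (f x).1 + (f y).1 /\
      (f (a *: x + y)).2 = a *: (f x).2 + (f y).2.
  by apply: red_decomposition_unique; rewrite -fP /= addrACA -scalerDr -!fP.
pose p : {linear X -> subspaceType M} :=
  HB.pack (fun x => (f x).1) (GRing.isLinear.Build R[i] X (subspaceType M) _ _ pl).
pose q : {linear X -> subspaceType N} :=
  HB.pack (fun x => (f x).2) (GRing.isLinear.Build R[i] X (subspaceType N) _ _ ql).
exists p, q; have fE x : x = val (p x) + val (q x) by exact: fP.
have cZ := prod_seq_complete (subspace_seq_complete cX (red_closedl MN))
  (subspace_seq_complete cX (red_closedr MN)).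
have le12 (z : subspaceType M * subspaceType N) : nrm z.1 <= nrm z /\ nrm z.2 <= nrm z.
  by rewrite nrm_prod !le_max !lexx orbT.
pose S : {linear (subspaceType M * subspaceType N)%type -> X} := red_sum_map.
have cS : continuous S.
  apply: (linear_continuousP S).2; exists 2 => // z; apply: le_trans (nrmD _ _) _.
  by have [? ?] := le12 z; rewrite -[nrm (val z.1)]/(nrm z.1) -[nrm (val z.2)]/(nrm z.2); lra.
have [||c c0 cP] := injective_closed_range_bounded_below cZ cX cS.
- rewrite (_ : range _ = setT); first exact: closedT.
  by apply/seteqP; split=> // x _; exists (p x, q x); rewrite // [RHS]fE.
- move=> [y z] yz; have [|-> ->//] := @red_decomposition_unique y 0 z 0.
  by rewrite [LHS]yz addr0.
have bound x : c * nrm (p x) <= nrm x /\ c * nrm (q x) <= nrm x.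
  have := cP (p x, q x); rewrite (_ : _ (p x, q x) = val (p x) + val (q x)) // -fE => h.
  by have [? ?] := le12 (p x, q x); split; apply: le_trans h; rewrite ler_pM2l.
by split=> //; [apply/(linear_continuousP p) | apply/(linear_continuousP q)];
  exists c^-1; rewrite ?invr_gt0 // => x; rewrite ler_pdivlMl //; have [] := bound x.
Qed.

End ReducingPair.

(** * The direct implication *)

Section BoundedBelowSummand.
Variables (R : realType) (X : normedModType R[i]) (T : {linear X -> X}).
Hypotheses (cX : seq_complete X) (cT : continuous T).
Variables (M N : submodClosed X) (MN : Red T M N).
Local Notation C := (R[i]^o).
Local Notation TM := (restr (red_invl MN)).
Local Notation TN := (restr (red_invr MN)).
Variables (p : {linear X -> subspaceType M}) (q : {linear X -> subspaceType N}).
Hypotheses (pqE : forall x, x = val (p x) + val (q x)) (cp : continuous p) (cq : continuous q).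

Lemma red_shift_op mu x : p (shift_op T mu x) = shift_op TM mu (p x) /\
  q (shift_op T mu x) = shift_op TN mu (q x).
Proof.
apply: (red_decomposition_unique MN); rewrite -pqE /shift_op {1 2}[x]pqE linearD scalerDr opprD.
by rewrite addrACA.
Qed.

Lemma red_iter_shift_op mu n x : p (iter n (shift_op T mu) x) = iter n (shift_op TM mu) (p x) /\
  q (iter n (shift_op T mu) x) = iter n (shift_op TN mu) (q x).
Proof.
elim: n => //= n [pn qn]; have [-> ->] := red_shift_op mu (iter n (shift_op T mu) x).
by rewrite pn qn.
Qed.

(** The set A is the whole space for the approximate point spectrum, and the range of a power at a
    pole of the resolvent of T_N. *)
Lemma red_shift_op_bounded_below mu (a b : R) (A : set X) : 0 < a -> 0 < b ->
  (forall x, A x -> a * nrm (p x) <= nrm (shift_op TM mu (p x))) ->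
  (forall x, A x -> b * nrm (q x) <= nrm (shift_op TN mu (q x))) ->
  exists2 c : R, 0 < c & forall x, A x -> c * nrm x <= nrm (shift_op T mu x).
Proof.
move=> a0 b0 aP bP.
have [K1 K10 K1P] := (linear_continuousP p).1 cp; have [K2 K20 K2P] := (linear_continuousP q).1 cq.
have k0 : 0 < K1 / a + K2 / b by rewrite addr_gt0 // divr_gt0.
exists (K1 / a + K2 / b)^-1 => [|x Ax]; first by rewrite invr_gt0.
rewrite ler_pdivrMl //; have [e1 e2] := red_shift_op mu x.
have h1 : nrm (p x) <= K1 / a * nrm (shift_op T mu x).
  rewrite mulrAC ler_pdivlMr // mulrC; apply: le_trans (aP x Ax) _; rewrite -e1; exact: K1P.
have h2 : nrm (q x) <= K2 / b * nrm (shift_op T mu x).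
  rewrite mulrAC ler_pdivlMr // mulrC; apply: le_trans (bP x Ax) _; rewrite -e2; exact: K2P.
have := nrmD (val (p x)) (val (q x)); rewrite -pqE mulrDl.
rewrite -[nrm (val (p x))]/(nrm (p x)) -[nrm (val (q x))]/(nrm (q x)); lra.
Qed.

Variable c0 : R.
Hypotheses (c0_gt0 : 0 < c0) (TM_bb : forall y, c0 * nrm y <= nrm (TM y)).
Hypothesis mN : meromorphic TN.

Lemma summand_bounded_below mu : nrm mu < c0 ->
  forall y, (c0 - nrm mu) * nrm y <= nrm (shift_op TM mu y).
Proof.
move=> mc y; rewrite mulrBl -nrmZ; have := TM_bb y; have := nrm_le_dist (TM y) (mu *: y).
rewrite -[TM y - _]/(shift_op TM mu y); lra.
Qed.

Lemma resolvent_bounded_below (V : normedModType R[i]) (S : {linear V -> V}) mu :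
  ~ spectrum S mu -> exists2 b : R, 0 < b & forall y, b * nrm y <= nrm (shift_op S mu y).
Proof.
move=> /contrapT[Rmu [bR RK _]]; have [K K0 KP] := bounded_op_nrm bR.
exists K^-1 => [|y]; first by rewrite invr_gt0.
by rewrite ler_pdivrMl //; have := KP (shift_op S mu y); rewrite RK.
Qed.

Lemma summand_not_interior_sigma_ap : ~ (interior (sigma_ap T)) 0.
Proof.
move=> /near_nrm[d d0 dP].
have m0 : 0 < Num.min d c0 by rewrite lt_min d0.
have [mu] := meromorphic_resolvent_dense 0 mN m0.
rewrite subr0 lt_min => /andP[md mc] nS; have [b b0 bP] := resolvent_bounded_below nS.
have := dP mu; rewrite sub0r nrmN => /(_ md); apply; apply/bounded_below_nrmP.
have a0 : 0 < c0 - nrm mu by rewrite subr_gt0.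
have [||c cp0 cP] := red_shift_op_bounded_below (mu := mu) (A := setT) a0 b0.
- by move=> x _; exact: summand_bounded_below.
- by move=> x _; exact: bP.
by exists c => // x; exact: cP.
Qed.

(* The discs in the SVEP need not be small: the identity theorem is needed on    *)
(* the M-part, where T - lam may fail to be injective away from 0.               *)
Lemma summand_SVEP : SVEP T 0.
Proof.
move=> r r0 f df Tf mu mur; have [r0' rE] := gt0C r0.
have ballE (w : C) : ball (0 : C) r w <-> nrm w < complex.Re r.
  by rewrite {1}rE -ball_normE /ball_ /= nrm_lt sub0r nrmN.
have dcomp (W : normedModType R[i]) (g : {linear X -> W}) w : continuous g ->
    ball (0 : C) r w -> derivable (fun z => g (f z)) w 1.
  move=> /linear_continuousP[K K0 KP] /df/derivable_nrmP[D DP]; apply/derivable_nrmP.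
  exists (g D) => e e0; have [|d d0 dP] := DP (e / K); first by rewrite divr_gt0.
  exists d => // h /dP hd; rewrite -linearB -linearZ -linearB; apply: le_trans (KP _) _.
  by rewrite mulrC -ler_pdivlMr // mulrAC.
have pf w : ball (0 : C) r w -> p (f w) = 0.
  move=> /ballE; rewrite -[w in nrm w]subr0; move: w.
  apply: (@identity_at_center _ _ (fun z => p (f z)) 0 _ (Num.min c0 (complex.Re r))).
  - by rewrite lt_min c0_gt0.
  - by move=> w; rewrite subr0 => /ballE; exact: dcomp.
  move=> w; rewrite subr0 lt_min => /andP[wc wr].
  have [e _] := red_shift_op w (f w); rewrite Tf ?linear0 in e; last exact/ballE.
  have := summand_bounded_below wc (p (f w)); rewrite -e nrm0 pmulr_rle0 ?subr_gt0 // => h.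
  by apply/nrm0_eq0/eqP; rewrite eq_le h nrm_ge0.
(* q (f z) vanishes at resolvent points z of T_N; these come arbitrarily close to w, where q (f z)
   is Lipschitz. *)
have qf w : ball (0 : C) r w -> q (f w) = 0.
  move=> wr; have [K [d d0 dP]] := derivable_locally_lipschitz (dcomp _ q w cq wr).
  move/ballE: wr => wr; apply/nrm0_eq0/eqP; rewrite eq_le nrm_ge0 andbT.
  apply: (@le0_of_small _ _ `|K| (Num.min d (complex.Re r - nrm w))) => [|t].
    by rewrite lt_min d0 subr_gt0.
  rewrite lt_min => /andP[t0 /andP[td tr]].
  have [z zw nS] := meromorphic_resolvent_dense w mN t0.
  have zr : nrm z < complex.Re r by have := nrm_le_dist z w; lra.
  have [_ e] := red_shift_op z (f z); rewrite Tf ?linear0 in e; last exact/ballE.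
  have [b b0 bP] := resolvent_bounded_below nS.
  have qz : q (f z) = 0.
    apply/nrm0_eq0/eqP; rewrite eq_le nrm_ge0 andbT -(pmulr_rle0 _ b0).
    by apply: le_trans (bP _) _; rewrite -e nrm0.
  have := dP z (lt_trans zw td); rewrite qz sub0r nrmN => /le_trans; apply.
  apply: (@le_trans _ _ (`|K| * nrm (z - w))); first by rewrite ler_wpM2r ?nrm_ge0 // ler_norm.
  by rewrite mulrC ler_wpM2r // ltW.
by rewrite [f mu]pqE pf // qf // addr0.
Qed.

Lemma iter_closed_range (V : normedModType R[i]) (S : {linear V -> V}) (c : R) n :
  seq_complete V -> continuous S -> 0 < c -> (forall y, c * nrm y <= nrm (S y)) ->
  closed (range (iter n S)).
Proof.
move=> cV cS cc cP; elim: n => [|n IH].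
  by rewrite (_ : range _ = setT); [exact: closedT | apply/seteqP; split=> // x _; exists x].
rewrite (_ : range _ = S @` range (iter n S)).
  by apply: (bounded_below_closed_image cV cS IH cc) => x _ y _; rewrite -linearB.
apply/seteqP; split=> [_ [x _ <-]|_ [_ [x _ <-] <-]]; first by exists (iter n S x) => //; exists x.
by exists x.
Qed.

(** The exponent n comes from [pole_range] at a spectral point of T_N and is 0 elsewhere. On the
    range of the n-th power T - mu is bounded below, so the restriction has zero kernel, closed
    range and ascent 0. *)
Lemma summand_upper_semi_B_Browder mu : mu != 0 -> nrm mu < c0 ->
  upper_semi_B_Browder (shift_op T mu).
Proof.
move=> mu0 mc; pose S : {linear X -> X} := shift_op T mu.
have cM := subspace_seq_complete cX (red_closedl MN).
have cN := subspace_seq_complete cX (red_closedr MN).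
have cTM : continuous TM by exact: restr_continuous.
have cTN : continuous TN by exact: restr_continuous.
have [n [clN [b b0 bP]]] : exists n, closed (range (iter n (shift_op TN mu))) /\
    exists2 b : R, 0 < b & forall x, range (iter n (shift_op TN mu)) x ->
      b * nrm x <= nrm (shift_op TN mu x).
  case: (pselect (spectrum TN mu)) => [Smu|nS]; first by apply: (pole_range cN cTN); exact: mN.
  have [b b0 bP] := resolvent_bounded_below nS.
  exists 0%N; split; last by exists b => // x _; exact: bP.
  by rewrite (_ : range _ = setT); [exact: closedT | apply/seteqP; split=> // x _; exists x].
have a0 : 0 < c0 - nrm mu by rewrite subr_gt0.
have clM : closed (range (iter n (shift_op TM mu))).
  apply: (iter_closed_range cM _ a0).
    exact: shift_op_continuous.
  exact: summand_bounded_below.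
(* The range of S^n is the sum of the ranges in M and N, and the continuous projections reduce its
   closedness to theirs. *)
have clX : closed (range (iter n S)).
  apply/closed_seq => u x uS ux.
  have pu : range (iter n (shift_op TM mu)) (p x).
    apply: ((closed_seq _).1 clM (fun k => p (u k))) => [k|e e0].
      by have [y _ <-] := uS k; exists (p y) => //; have [<- _] := red_iter_shift_op mu n y.
    have [K K0 KP] := (linear_continuousP p).1 cp.
    have [Nn NP] := ux (e / K) ltac:(by rewrite divr_gt0); exists Nn => k kN.
    by rewrite -linearB; apply: le_lt_trans (KP _) _; rewrite mulrC -ltr_pdivlMr // NP.
  have qu : range (iter n (shift_op TN mu)) (q x).
    apply: ((closed_seq _).1 clN (fun k => q (u k))) => [k|e e0].
      by have [y _ <-] := uS k; exists (q y) => //; have [_ <-] := red_iter_shift_op mu n y.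
    have [K K0 KP] := (linear_continuousP q).1 cq.
    have [Nn NP] := ux (e / K) ltac:(by rewrite divr_gt0); exists Nn => k kN.
    by rewrite -linearB; apply: le_lt_trans (KP _) _; rewrite mulrC -ltr_pdivlMr // NP.
  have [y _ yE] := pu; have [z _ zE] := qu; exists (val y + val z) => //.
  rewrite linearD [x in RHS]pqE -yE -zE; congr (_ + _).
    by elim: (n) => //= k ->.
  by elim: (n) => //= k ->.
have [||c cc cP] := red_shift_op_bounded_below (mu := mu) (A := range (iter n S)) a0 b0.
- by move=> x _; exact: summand_bounded_below.
- by move=> _ [y _ <-]; apply: bP; exists (q y) => //; have [_ <-] := red_iter_shift_op mu n y.
pose W := range_submod (iter n S).
have WE : [set` W] = range (iter n S) := range_submodE (iter n S).
have TW : invariant_subspace W S.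
  move=> x xW; have : [set` W] x by []; rewrite WE => -[y _ <-].
  suff : [set` W] (S (iter n S y)) by [].
  by rewrite WE; exists (S y) => //; rewrite -iterSr.
have WP (w : subspaceType W) : range (iter n S) (val w).
  by rewrite -WE; exact: (valP w).
have bW : bounded_below (restr TW).
  by apply/bounded_below_nrmP; exists c => // w; exact: (cP _ (WP w)).
have inj (w : subspaceType W) : restr TW w = 0 -> w = 0.
  move=> w0; have /bounded_below_nrmP[a aa aP] := bW; have := aP w.
  rewrite w0 nrm0 pmulr_rle0 // => h; apply/nrm0_eq0/eqP.
  by rewrite eq_le h nrm_ge0.
exists n, W, TW; split=> //; split; first split.
- exists 0%N, (fun=> 0) => w /inj ->; exists (fun=> 0); by rewrite big_ord0.
- have cW : seq_complete (subspaceType W) by apply: subspace_seq_complete => //; rewrite WE.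
  by have [] := bounded_below_Kato cW (restr_continuous (TW := TW) (shift_op_continuous cT)) bW.
exists 0%N; apply/seteqP; split=> w /=; last exact: inj.
by rewrite /nullspace /= => ->; exact: linear0.
Qed.

Lemma summand_not_limit_sigma_BB : ~ limit_point (sigma_BB T) 0.
Proof.
have /near_nrm nbh0 : exists2 d : R, 0 < d & forall y : C, nrm (0 - y) < d -> nrm y < c0.
  by exists c0 => // y; rewrite sub0r nrmN.
move=> /(_ _ nbh0)[mu [mu0 BBmu mc]].
exact: BBmu (summand_upper_semi_B_Browder mu0 mc).
Qed.

End BoundedBelowSummand.

(** * The equivalences *)

Section Equivalence.
Variables (R : realType) (X : completeNormedModType R[i]) (T : {linear X -> X}).
Hypothesis cT : continuous T.
Local Notation C := (R[i]^o).

Definition bounded_below_plus_meromorphic := exists (M N : submodClosed X) (MN : Red T M N),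
  bounded_below (restr (red_invl MN)) /\ meromorphic (restr (red_invr MN)).

Lemma bounded_below_summandP : bounded_below_plus_meromorphic ->
  [/\ gen_Kato_meromorphic T, ~ (interior (sigma_ap T)) 0, SVEP T 0 & ~ limit_point (sigma_BB T) 0].
Proof.
move=> [M [N [MN [bM mN]]]]; have cX := completeNormedMod_seq (V := X).
have [c c0 cP] := (bounded_below_nrmP _).1 bM.
have [p [q [pqE cp cq]]] := red_projections cX MN.
split.
- exists M, N, MN; split=> //; apply: bounded_below_Kato bM; last exact: restr_continuous.
  exact: subspace_seq_complete cX (red_closedl MN).
- exact: (summand_not_interior_sigma_ap pqE cp cq c0 cP mN).
- exact: (summand_SVEP pqE cp cq c0 cP mN).
exact: (summand_not_limit_sigma_BB cX cT pqE cp cq c0 cP mN).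
Qed.

Lemma gen_Kato_meromorphic_dichotomy : gen_Kato_meromorphic T ->
  bounded_below_plus_meromorphic \/ exists c x, eigenchain T c x.
Proof.
move=> [M [N [MN [kM mN]]]]; have cX := completeNormedMod_seq (V := X).
have cM := subspace_seq_complete cX (red_closedl MN).
have cTM : continuous (restr (red_invl MN)) by exact: restr_continuous.
case: (pselect (exists2 x, x <> 0 & restr (red_invl MN) x = 0)) => [[x x0 Tx0]|inj]; [right|left].
  have [c [y yc]] := Kato_eigenchain cM cTM kM x0 Tx0.
  by exists c, (fun k => val (y k)); exact: eigenchain_subspace yc.
exists M, N, MN; split=> //; apply: Kato_injective_bounded_below => // x Tx0.
by apply: contrapT => x0; apply: inj; exists x.
Qed.

Lemma eigenchain_interior (A : set C) (c : R) (x : nat -> X) : eigenchain T c x ->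
  (forall lam : C, nrm lam * c <= 4^-1 -> A lam) -> (interior A) 0.
Proof.
move=> [c0 _ _ _ _] AP; apply/(near_nrm (V := C) 0 A); exists (4^-1 / c) => [|lam].
  by rewrite divr_gt0.
by rewrite sub0r nrmN ltr_pdivlMr // => /ltW; exact: AP.
Qed.

End Equivalence.

Theorem theorem2p5 (R : realType) (X : completeNormedModType R[i])
    (X_infinite_dim : ~ finite_dim [set: X])
    (T : {linear X -> X}) (T_bounded : continuous T) :
  [<-> exists (M N : submodClosed X) (MN : Red T M N),
         bounded_below (restr (red_invl MN)) /\
         meromorphic (restr (red_invr MN));
       gen_Kato_meromorphic T /\ ~ (interior (sigma_ap T)) 0;
       gen_Kato_meromorphic T /\ SVEP T 0;
       gen_Kato_meromorphic T /\ ~ limit_point (sigma_BB T) 0;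
       gen_Kato_meromorphic T /\ ~ (interior (sigma_BB T)) 0].
Proof.
have cX := completeNormedMod_seq (V := X).
have direct := bounded_below_summandP T_bounded.
have dich := gen_Kato_meromorphic_dichotomy T_bounded.
tfae.
- by move=> /direct[].
- move=> [gT nap]; have [H|[c [x xc]]] := dich gT; first by have [] := direct H.
  case: nap; apply: (eigenchain_interior xc) => lam.
  exact: eigenchain_not_bounded_below xc.
- move=> [gT sv]; have [H|[c [x xc]]] := dich gT; first by have [] := direct H.
  by case: (eigenchain_not_SVEP cX T_bounded xc).
(* If 0 were interior, every neighbourhood of 0 would contain the non-zero spectral point d / 2 for
   a small d. *)
- move=> [gT nlim]; split=> // BB0; apply: nlim => U U0.
  have [d d0 dP] := (near_nrm (V := R[i]^o) 0 _).1 (filterI U0 BB0).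
  have d2 : 0 < d / 2 by rewrite divr_gt0.
  exists (d / 2)%:C; have [|Uy By] := dP (d / 2)%:C.
    by rewrite sub0r nrmN nrmC gtr0_norm //; lra.
  by split=> //; rewrite eq_complex /= gt_eqF.
move=> [gT nBB]; have [H|[c [x xc]]] := dich gT; first exact: H.
case: nBB; apply: (eigenchain_interior xc) => lam.
exact: eigenchain_not_BBrowder xc.
Qed.
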